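(* Let $p\in\mathbb{C}[z_1,z_2]$ be a polynomial with no zeros in $\mathbb{H}^2$ and $p(0,0)=0$, and let $p$ have Weierstrass factorization $p=u\,p_1\cdots p_k$ near $(0,0)$, where $u\in\mathbb{C}\{z_1,z_2\}$ is a unit and each $p_j\in\mathbb{C}\{z_1\}[z_2]$ is an irreducible Weierstrass polynomial in $z_2$ of degree $M_j$. (a) If $p$ is pure stable, then near $(0,0)$ $$p(z)=u(z)\prod_{j=1}^{k}\prod_{m=1}^{M_j}\left(z_2+q_j(z_1)+z_1^{2L_j}\psi_j(\mu_j^m z_1^{1/M_j})\right),$$ where each $L_j$ is a positive integer, $\mu_j=e^{2\pi i/M_j}$, $q_j\in\mathbb{R}[z_1]$ with $q_j(0)=0$, $q_j'(0)>0$, $\deg q_j<2L_j$, and $\psi_j$ is holomorphic near $0\in\mathbb{C}$ with $\operatorname{Im}\psi_j(0)>0$. (b) If $p$ is real stable and has no monomial factors (neither $z_1$ nor $z_2$ divides $p$), then each $M_j=1$ and near $(0,0)$ $$p(z)=u(z)\prod_{j=1}^{k}(z_2+\phi_j(z_1)),$$ where each $\phi_j$ is holomorphic near $0$ with real power series coefficients, $\phi_j(0)=0$ and $\phi_j'(0)>0$.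
   Context: $\mathbb{H}$ is the open upper half plane. For a polynomial $p$, $\bar p(z)=\overline{p(\bar z_1,\bar z_2)}$. A polynomial with no zeros in $\mathbb{H}^2$ is pure stable if it has no nonconstant factor in common with $\bar p$, and real stable if $p=c\bar p$ for some constant $c$ with $|c|=1$. $\mathbb{C}\{z_1\}$ and $\mathbb{C}\{z_1,z_2\}$ are the rings of convergent power series at the origin; a unit is an element not vanishing at the origin. A Weierstrass polynomial in $z_2$ is a monic polynomial in $z_2$ whose non-leading coefficients belong to $\mathbb{C}\{z_1\}$ and vanish at $z_1=0$. A product over $m=1,\dots,M_j$ of expressions involving $\mu_j^m z_1^{1/M_j}$ is understood by substituting for $z_1^{1/M_j}$ any number $t$ with $t^{M_j}=z_1$; the product does not depend on the choice of $t$. *)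

(* Defs.v *)
From HB Require Import structures.
From mathcomp Require Import all_boot all_order all_algebra.
From mathcomp Require Import all_classical all_reals all_analysis.
From mathcomp Require Import complex.

Set Implicit Arguments.
Unset Strict Implicit.
Unset Printing Implicit Defensive.

Import Order.TTheory GRing.Theory Num.Theory.
Import numFieldNormedType.Exports.

Local Open Scope classical_set_scope.
Local Open Scope ring_scope.

(* R[i] bundled as a numClosedFieldType: in this form the norm topology of
   MathComp-Analysis is found by inference, which it is not for R[i] itself. *)
Definition C (R : realType) : numClosedFieldType := R[i].

Section ConvergentPowerSeries.
Variable K : numClosedFieldType.
Implicit Types a b : nat -> K.

(* Absolute summability at some positive radius. The order of K is partial, so
   [0 < r] forces r to be real, and the inequality forces B to be real. *)
Definition ps_convergent a : Prop := exists r B : K,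
  0 < r /\ forall n : nat, \sum_(i < n) `|a i| * r ^+ i <= B.

Definition ps_mul a b : nat -> K :=
  fun n => \sum_(i < n.+1) a i * b (n - i)%N.

Record cvps := CVPS {
  cvps_coef :> nat -> K;
  cvps_convergent : `[< ps_convergent cvps_coef >] }.

HB.instance Definition _ := [isSub for cvps_coef].
HB.instance Definition _ := [Choice of cvps by <:].

Let cvpsP (f g : cvps) : f =1 g -> f = g.
Proof. by move=> fg; apply: val_inj; apply/funext. Qed.

Let le_sum a (n : nat) (r s B : K) : 0 < s -> s <= r ->
  \sum_(i < n) `|a i| * r ^+ i <= B -> \sum_(i < n) `|a i| * s ^+ i <= B.
Proof.
move=> s0 sr; apply: le_trans; apply: ler_sum => i _.
by rewrite ler_wpM2l// lerXn2r// nnegrE ltW// (lt_le_trans s0).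
Qed.

Let common a b : ps_convergent a -> ps_convergent b -> exists r A B : K,
  [/\ 0 < r, forall n : nat, \sum_(i < n) `|a i| * r ^+ i <= A
    & forall n : nat, \sum_(i < n) `|b i| * r ^+ i <= B].
Proof.
move=> [r [A [r0 hA]]] [s [B [s0 hB]]].
have [rs|sr] := orP (real_leVge (gtr0_real r0) (gtr0_real s0)).
- by exists r, A, B; split=> // n; apply: le_sum (hB n).
- by exists s, A, B; split=> // n; apply: le_sum (hA n).
Qed.

Let convergent_poly a (N : nat) :
  (forall n : nat, (N <= n)%N -> a n = 0) -> ps_convergent a.
Proof.
move=> aN; exists 1, (\sum_(i < N) `|a i|); split=> // n.
under eq_bigr do rewrite expr1n mulr1.
have [nN|/ltnW Nn] := leqP n N.
  rewrite -(subnKC nN) big_split_ord/= lerDl.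
  by apply: sumr_ge0 => i _; exact: normr_ge0.
rewrite -(subnKC Nn) big_split_ord/= [X in _ + X]big1 ?addr0//.
by move=> i _; rewrite aN ?normr0// leq_addr.
Qed.

Let convergent0 : ps_convergent (fun=> 0).
Proof. by apply: (@convergent_poly _ 0). Qed.

Let convergent1 : ps_convergent (fun n => (n == 0)%:R).
Proof. by apply: (@convergent_poly _ 1) => -[]. Qed.

Let convergentN a : ps_convergent a -> ps_convergent (fun n => - a n).
Proof.
by move=> [r [B [r0 h]]]; exists r, B; split=> // n; under eq_bigr do rewrite normrN.
Qed.

Let convergentD a b :
  ps_convergent a -> ps_convergent b -> ps_convergent (fun n => a n + b n).
Proof.
move=> ca cb; have [r [A [B [r0 hA hB]]]] := common ca cb.
exists r, (A + B); split=> // n; apply: le_trans (lerD (hA n) (hB n)).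
rewrite -big_split/=; apply: ler_sum => i _; rewrite -mulrDl.
by rewrite ler_wpM2r ?ler_normD// exprn_ge0// ltW.
Qed.

Let mul_poly a b (n N : nat) : (n < N)%N ->
  ps_mul a b n = ((\poly_(i < N) a i) * (\poly_(i < N) b i))`_n.
Proof.
move=> nN; rewrite coefM; apply: eq_bigr => i _; rewrite !coef_poly.
by rewrite (leq_ltn_trans _ nN) ?leq_ord// (leq_ltn_trans (leq_subr _ _) nN).
Qed.

Let convergentM a b :
  ps_convergent a -> ps_convergent b -> ps_convergent (ps_mul a b).
Proof.
move=> ca cb; have [r [A [B [r0 hA hB]]]] := common ca cb.
exists r, (A * B); split=> // N.
pose pa := \poly_(i < N) (`|a i| * r ^+ i).
pose pb := \poly_(i < N) (`|b i| * r ^+ i).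
have ge0 (c : nat -> K) i : 0 <= (\poly_(i < N) (`|c i| * r ^+ i))`_i.
  by rewrite coef_poly; case: ifP => // _; rewrite mulr_ge0// exprn_ge0// ltW.
have hpa : pa.[1] <= A.
  rewrite horner_poly; apply: le_trans (hA N).
  by apply: ler_sum => i _; rewrite expr1n mulr1.
have hpb : pb.[1] <= B.
  rewrite horner_poly; apply: le_trans (hB N).
  by apply: ler_sum => i _; rewrite expr1n mulr1.
have p0 (c : nat -> K) : 0 <= (\poly_(i < N) (`|c i| * r ^+ i)).[1].
  rewrite horner_coef; apply: sumr_ge0 => i _.
  by rewrite expr1n mulr1 ge0.
apply: le_trans (ler_pM (p0 a) (p0 b) hpa hpb); rewrite -hornerM.
rewrite (@horner_coef_wide _ (N + size (pa * pb))) ?leq_addl//.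
rewrite big_split_ord/= -[leLHS]addr0; apply: lerD; last first.
  apply: sumr_ge0 => i _; rewrite expr1n mulr1 coefM.
  by apply: sumr_ge0 => j _; rewrite mulr_ge0.
apply: ler_sum => n _; rewrite expr1n mulr1.
have -> : (pa * pb)`_n = \sum_(i < n.+1) `|a i| * `|b (n - i)%N| * r ^+ n.
  rewrite -(mul_poly (fun i => `|a i| * r ^+ i) (fun i => `|b i| * r ^+ i))//.
  apply: eq_bigr => i _; rewrite mulrACA -exprD subnKC//.
  by rewrite -ltnS.
rewrite -mulr_suml ler_wpM2r ?exprn_ge0 ?(ltW r0)//.
apply: le_trans (ler_norm_sum _ _ _) _.
by apply: ler_sum => i _; rewrite normrM.
Qed.

Let mk a (ca : ps_convergent a) : cvps := CVPS (introT (asboolP _) ca).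
Let conv (f : cvps) : ps_convergent f := elimT (asboolP _) (cvps_convergent f).

Definition cvps0 : cvps := mk convergent0.
Definition cvps1 : cvps := mk convergent1.
Definition cvps_opp (f : cvps) : cvps := mk (convergentN (conv f)).
Definition cvps_add (f g : cvps) : cvps := mk (convergentD (conv f) (conv g)).
Definition cvps_mul (f g : cvps) : cvps := mk (convergentM (conv f) (conv g)).

Let addA : associative cvps_add.
Proof. by move=> f g h; apply: cvpsP => n; exact: addrA. Qed.
Let addC : commutative cvps_add.
Proof. by move=> f g; apply: cvpsP => n; exact: addrC. Qed.
Let add0 : left_id cvps0 cvps_add.
Proof. by move=> f; apply: cvpsP => n; exact: add0r. Qed.
Let addN : left_inverse cvps0 cvps_opp cvps_add.
Proof. by move=> f; apply: cvpsP => n; exact: addNr. Qed.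

HB.instance Definition _ := GRing.isZmodule.Build cvps addA addC add0 addN.

Let mulC : commutative cvps_mul.
Proof.
by move=> f g; apply: cvpsP => n /=; rewrite !(@mul_poly _ _ _ n.+1)// mulrC.
Qed.
Let mulA : associative cvps_mul.
Proof.
move=> f g h; apply: cvpsP => n /=; rewrite !(@mul_poly _ _ _ n.+1)//.
transitivity (((\poly_(i < n.+1) f i) * (\poly_(i < n.+1) g i)
               * (\poly_(i < n.+1) h i))`_n).
  rewrite -mulrA !coefM; apply: eq_bigr => i _; congr (_ * _).
  by rewrite coef_poly ltnS leq_subr (@mul_poly _ _ _ n.+1)// ltnS leq_subr.
rewrite !coefM; apply: eq_bigr => i _; congr (_ * _).
by rewrite [RHS]coef_poly ltn_ord (@mul_poly _ _ _ n.+1).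
Qed.
Let mul1 : left_id cvps1 cvps_mul.
Proof.
move=> f; apply: cvpsP => n /=.
by rewrite /ps_mul big_ord_recl/= mul1r subn0 big1 ?addr0// => i _; rewrite mul0r.
Qed.
Let mulD : left_distributive cvps_mul cvps_add.
Proof.
move=> f g h; apply: cvpsP => n /=; rewrite /ps_mul -big_split/=.
by apply: eq_bigr => i _; rewrite mulrDl.
Qed.
Let one_neq0 : cvps1 != 0.
Proof.
by apply/eqP => /(congr1 (fun f : cvps => f 0)) /eqP; rewrite /= oner_eq0.
Qed.

HB.instance Definition _ :=
  GRing.Zmodule_isComNzRing.Build cvps mulA mulC mul1 mulD one_neq0.

Definition cvps_eval (f : cvps) (w : K) : K :=
  limn ([series f n * w ^+ n]_n : nat -> K).

Definition ps2_convergent (u : nat -> nat -> K) : Prop := exists r B : K,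
  0 < r /\
  forall n : nat, \sum_(i < n) \sum_(j < n) `|u i j| * r ^+ (i + j) <= B.

(* Near the origin the double series converges absolutely, so summing over
   squares gives its sum. *)
Definition ps2_eval (u : nat -> nat -> K) (z : K * K) : K :=
  limn ((fun n => \sum_(i < n) \sum_(j < n) u i j * z.1 ^+ i * z.2 ^+ j)
          : nat -> K).

(* [{poly cvps}] is the ring K{z1}[z2]; the polynomial variable is z2. *)
Definition is_weierstrass (P : {poly cvps}) : Prop :=
  P \is monic /\ forall i : nat, (i < (size P).-1)%N -> (P`_i : cvps) 0 = 0.

Definition weierstrass_eval (P : {poly cvps}) (z : K * K) : K :=
  \sum_(i < size P) cvps_eval P`_i z.1 * z.2 ^+ i.

End ConvergentPowerSeries.

Section TwoVariablePolynomials.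
Variable K : numClosedFieldType.

(* [{poly {poly K}}] is K[z1][z2]: the inner variable is z1, the outer z2. *)
Definition eval2 (p : {poly {poly K}}) (z : K * K) : K := p.[z.2%:P].[z.1].

Definition var1 : {poly {poly K}} := 'X%:P.
Definition var2 : {poly {poly K}} := 'X.

Definition bar (p : {poly {poly K}}) : {poly {poly K}} :=
  map_poly (map_poly (@Num.conj K)) p.

Lemma bar_eval (p : {poly {poly K}}) (z : K * K) :
  eval2 (bar p) z = (eval2 p (z.1^*, z.2^*))^*.
Proof.
rewrite /eval2 /bar -horner_map /= conjCK.
by rewrite -horner_map /= map_polyC /= conjCK.
Qed.

Definition const2 (p : {poly {poly K}}) : Prop := exists c : K, p = c%:P%:P.

Definition no_zeros_H2 (p : {poly {poly K}}) : Prop :=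
  forall z : K * K, 0 < 'Im z.1 -> 0 < 'Im z.2 -> eval2 p z != 0.

End TwoVariablePolynomials.

(* Divisibility and irreducibility in a commutative ring. The relation [%|] of
   polydiv on [{poly S}] is divisibility up to a scalar of S, so it is not
   divisibility in [{poly S}] unless S is a field; likewise
   [irreducible_poly]. *)
Definition ring_divides (S : comNzRingType) (x y : S) : Prop :=
  exists c : S, y = c * x.

Definition ring_unit (S : comNzRingType) (x : S) : Prop :=
  exists y : S, x * y = 1.

Definition ring_irreducible (S : comNzRingType) (x : S) : Prop :=
  ~ ring_unit x /\ forall a b : S, x = a * b -> ring_unit a \/ ring_unit b.

Definition pure_stable (K : numClosedFieldType) (p : {poly {poly K}}) : Prop :=
  no_zeros_H2 p /\
  forall d : {poly {poly K}},
    ring_divides d p -> ring_divides d (bar p) -> const2 d.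

Definition real_stable (K : numClosedFieldType) (p : {poly {poly K}}) : Prop :=
  no_zeros_H2 p /\ exists c : K, `|c| = 1 /\ p = c%:P%:P * bar p.

Section Holomorphic.
Variable R : realType.

(* [C R] is a normed module over itself, so [derivable _ _ 1] is complex
   differentiability. *)
Definition holomorphic_near0 (f : C R -> C R) : Prop :=
  \forall w \near (0 : C R), derivable f w 1.

Definition real_coefficients_near0 (f : C R -> C R) : Prop :=
  exists a : nat -> R, \forall w \near (0 : C R),
    ([series ((a n)%:C)%C * w ^+ n]_n : nat -> C R) @ \oo --> f w.

Definition real_poly_eval (q : {poly R}) (w : C R) : C R :=
  (map_poly (real_complex R) q : {poly C R}).[w].

(* exp (2 pi i / M) *)
Definition mu (M : nat) : C R :=
  (cos (2 * pi / M%:R) +i* sin (2 * pi / M%:R))%C.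

End Holomorphic.

(* Main.v *)
Require Import Defs.
From HB Require Import structures.
From mathcomp Require Import all_boot all_order all_algebra.
From mathcomp Require Import all_classical all_reals all_analysis.
From mathcomp Require Import complex.
From mathcomp Require Import ring lra zify.

Set Implicit Arguments.
Unset Strict Implicit.
Unset Printing Implicit Defensive.

Import Order.TTheory GRing.Theory Num.Theory.
Import numFieldNormedType.Exports.

Local Open Scope classical_set_scope.
Local Open Scope ring_scope.

(** Puiseux's theorem for convergent series turns an irreducible Weierstrass
    factor of degree M into a single branch: with z1 = t^M it is the product of
    the z2 + phi(mu^m t) over m = 1..M.  Its existence is proved by the Newton
    polygon and Hensel's lemma, whose convergence is a quadratic majorant
    estimate.

    Absence of zeros in H^2 says that Im phi(t) >= 0 whenever Im (t^M) >= 0, for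
    small t.  Let n be the first index at which phi_n is not real, or is nonzero
    with M not dividing n; the earlier terms are real where t^M is real, so
    Im (phi_n v^n) >= 0 whenever v^M = 1 or v^M = -1.  If M did not divide n,
    the sum of phi_n v^n over each of these two sets of v would vanish, so that
    all these numbers would be real, which is impossible.  Hence n = M l and
    Im phi_n > 0, and the case v^M = -1 shows that l = 2 L is even.  The same
    averaging shows that phi starts with a positive multiple of t^M.

    If there is no such n, irreducibility gives M = 1 and the branch is a real
    analytic curve.  Then p and its reflection both vanish on it, so they have a
    common factor: this is excluded for pure stable p.  If p is real stable, the
    conjugate branch is also a branch of p, so the case n = 2 L M is excluded. *)

(** * Convergent power series in one variable *)

(** Series are kept as coefficient sequences, so Puiseux's theorem is algebra in the ring [cvps],
    where z1 = t^d and t -> c t act as ring endomorphisms. Evaluation is multiplicative only near 0,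
    with a radius depending on the series; hence every analytic identity is stated for all small
    arguments.

    The hypothesis on zeros concerns the open set Im (t^M) > 0, whereas the decisive v, with v^M = 1
    or v^M = -1, lie on its boundary: the sign condition must first be extended to the closure.
    Leading terms are then compared along rays t = r v with r > 0, where real terms drop out of the
    imaginary part and the first other term dominates.

    The contradiction when M does not divide n is arithmetic: for z of order 2M, the reality of
    phi_n and of phi_n z^n makes z^n a real root of unity, so z^(2n) = 1 and M divides n.

    A real branch is only a convergent series, so the common factor of p and its reflection is not
    visible in it. It is obtained as a polynomial of least degree vanishing on the branch, which
    divides every other such polynomial. *)

Section ConvergenceCriteria.
Variable K : numClosedFieldType.
Implicit Types a b : nat -> K.

(** A geometric bound is easier to transport than a bounded sum. The condition [1 <= rho] makes the
    bound increasing in n, as ramification and rotation require. *)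
Lemma ps_convergentP a : ps_convergent a <->
  exists B rho : K, [/\ 0 <= B, 1 <= rho & forall n, `|a n| <= B * rho ^+ n].
Proof.
split=> [[r [B [r0 aB]]]|[B [rho [B0 rho1 aB]]]].
- have rV0 : 0 <= r^-1 by rewrite invr_ge0 ltW.
  have B0 : 0 <= B by have := aB 0%N; rewrite big_ord0.
  exists B, (1 + r^-1); split=> // [|n]; first by rewrite lerDl.
  have rn0 : 0 < r ^+ n by rewrite exprn_gt0.
  have /le_trans-> // : `|a n| <= B * r^-1 ^+ n.
    rewrite exprVn ler_pdivlMr//; apply: le_trans (aB n.+1).
    rewrite big_ord_recr/= lerDr; apply: sumr_ge0 => i _.
    by rewrite mulr_ge0// exprn_ge0// ltW.
  by rewrite ler_wpM2l// lerXn2r// ?nnegrE ?addr_ge0// lerDr.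
- have rho0 : 0 < rho by apply: lt_le_trans rho1.
  (* At this radius the i-th term is at most B / 2^i, and these sum to at most 2 B. *)
  exists (2 * rho)^-1, (2 * B); split=> [|n]; first by rewrite invr_gt0 mulr_gt0.
  have <- : \sum_(i < n) B * 2^-1 ^+ i + 2 * B * 2^-1 ^+ n = 2 * B.
    elim: n => [|n IHn]; first by rewrite big_ord0 add0r expr0 mulr1.
    rewrite big_ord_recr/= -[RHS]IHn exprS -!addrA; congr (_ + _).
    by move: (2^-1 ^+ n) => x; field.
  rewrite -[leLHS]addr0 lerD//; last first.
    by rewrite !mulr_ge0// exprn_ge0// invr_ge0.
  apply: ler_sum => i _; rewrite -ler_pdivlMr ?exprn_gt0 ?invr_gt0 ?mulr_gt0//.
  apply: le_trans (aB i) _; rewrite -mulrA; apply: ler_wpM2l => //.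
  rewrite -exprVn invrK exprMn mulrA -exprMn mulVf ?pnatr_eq0//.
  by rewrite expr1n mul1r.
Qed.

Lemma ps_mul_poly a b (n N : nat) : (n < N)%N ->
  ps_mul a b n = ((\poly_(i < N) a i) * (\poly_(i < N) b i))`_n.
Proof.
move=> nN; rewrite coefM; apply: eq_bigr => i _; rewrite !coef_poly.
by rewrite (leq_ltn_trans _ nN) ?leq_ord// (leq_ltn_trans (leq_subr _ _) nN).
Qed.

Definition ps_scale (c : K) a n := a n * c ^+ n.
(* For [d = 0] this is the constant series [a 0]. *)
Definition ps_ramify (d : nat) a n := if (d %| n)%N then a (n %/ d)%N else 0.
Definition ps_unramify (d : nat) a n := a (n * d)%N.
Definition ps_tail (k : nat) a n := a (n + k)%N.

Lemma ps_convergent_scale c a : ps_convergent a -> ps_convergent (ps_scale c a).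
Proof.
move=> /ps_convergentP[B [rho [B0 rho1 aB]]]; apply/ps_convergentP.
have rho0 : 0 <= rho by apply: le_trans rho1.
exists B, (rho * (1 + `|c|)); split=> // [|n].
  by apply: le_trans rho1 _; rewrite ler_peMr// lerDl.
rewrite normrM exprMn mulrA; apply: ler_pM => //; rewrite ?aB// normrX.
by rewrite lerXn2r ?nnegrE ?addr_ge0// lerDr.
Qed.

Lemma ps_convergent_ramify d a : ps_convergent a -> ps_convergent (ps_ramify d a).
Proof.
move=> /ps_convergentP[B [rho [B0 rho1 aB]]]; apply/ps_convergentP.
have rho0 : 0 <= rho by apply: le_trans rho1.
exists B, rho; split=> // n; rewrite /ps_ramify; case: ifP => _.
  by apply: le_trans (aB _) _; rewrite ler_wpM2l// ler_weXn2l// leq_div.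
by rewrite normr0 mulr_ge0// exprn_ge0.
Qed.

Lemma ps_convergent_unramify d a :
  ps_convergent a -> ps_convergent (ps_unramify d a).
Proof.
move=> /ps_convergentP[B [rho [B0 rho1 aB]]]; apply/ps_convergentP.
have rho0 : 0 <= rho by apply: le_trans rho1.
exists B, (rho ^+ d); split=> // [|n]; first exact: exprn_ege1.
by rewrite -exprM mulnC; exact: aB.
Qed.

Lemma ps_convergent_tail k a : ps_convergent a -> ps_convergent (ps_tail k a).
Proof.
move=> /ps_convergentP[B [rho [B0 rho1 aB]]]; apply/ps_convergentP.
have rho0 : 0 <= rho by apply: le_trans rho1.
exists (B * rho ^+ k), rho; split=> // [|n]; first by rewrite mulr_ge0// exprn_ge0.
by rewrite -mulrA -exprD addnC; exact: aB.
Qed.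

Lemma ps_convergent_poly (q : {poly K}) : ps_convergent (fun n => q`_n).
Proof.
apply/ps_convergentP; exists (\sum_(i < size q) `|q`_i|), 1; split=> // [|n].
  by apply: sumr_ge0.
rewrite expr1n mulr1; have [nq|qn] := ltnP n (size q); last first.
  by rewrite nth_default// normr0; apply: sumr_ge0.
by rewrite (bigD1 (Ordinal nq))//= lerDl; apply: sumr_ge0.
Qed.

End ConvergenceCriteria.

(** * Ring morphisms of convergent series: constant term, rotation, ramification *)

Section CvpsRing.
Variable K : numClosedFieldType.
Implicit Types f g : cvps K.

Lemma cvpsP f g : f =1 g <-> f = g.
Proof. by split=> [fg|->//]; apply: val_inj; apply/funext. Qed.

Lemma cvps_conv f : ps_convergent f.
Proof. exact: elimT (asboolP _) (cvps_convergent f). Qed.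

Definition mk_cvps (a : nat -> K) (ca : ps_convergent a) : cvps K :=
  CVPS (introT (asboolP _) ca).

Lemma coef_cvps0 n : (0 : cvps K) n = 0. Proof. by []. Qed.
Lemma coef_cvps1 n : (1 : cvps K) n = (n == 0)%:R. Proof. by []. Qed.
Lemma coef_cvpsD f g n : (f + g) n = f n + g n. Proof. by []. Qed.
Lemma coef_cvpsN f n : (- f) n = - f n. Proof. by []. Qed.
Lemma coef_cvpsM f g n : (f * g) n = \sum_(i < n.+1) f i * g (n - i)%N.
Proof. by []. Qed.
Lemma coef_cvps_sum (I : Type) (r : seq I) (Q : pred I) (F : I -> cvps K) n :
  (\sum_(i <- r | Q i) F i) n = \sum_(i <- r | Q i) F i n.
Proof. by elim/big_rec2 : _ => // i x y _ <-. Qed.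

Definition cvps_const_coef f : K := f 0%N.

Lemma cvps_const_coef_zmod : zmod_morphism cvps_const_coef.
Proof. by []. Qed.
Lemma cvps_const_coef_monoid : monoid_morphism cvps_const_coef.
Proof. by split=> // f g; rewrite /cvps_const_coef coef_cvpsM big_ord1. Qed.
HB.instance Definition _ := GRing.isZmodMorphism.Build
  (cvps K) K cvps_const_coef cvps_const_coef_zmod.
HB.instance Definition _ := GRing.isMonoidMorphism.Build
  (cvps K) K cvps_const_coef cvps_const_coef_monoid.

Definition cvps_scale (c : K) f := mk_cvps (ps_convergent_scale c (cvps_conv f)).

Lemma cvps_scale_zmod c : zmod_morphism (cvps_scale c).
Proof. by move=> f g; apply/cvpsP => n /=; rewrite /ps_scale mulrBl. Qed.
Lemma cvps_scale_monoid c : monoid_morphism (cvps_scale c).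
Proof.
split=> [|f g]; apply/cvpsP => n /=; rewrite /ps_scale.
  by case: n => [|n]; rewrite ?mul0r// mul1r.
rewrite mulr_suml; apply: eq_bigr => i _ /=.
by rewrite mulrACA -exprD subnKC// -ltnS.
Qed.
HB.instance Definition _ c := GRing.isZmodMorphism.Build
  (cvps K) (cvps K) (cvps_scale c) (cvps_scale_zmod c).
HB.instance Definition _ c := GRing.isMonoidMorphism.Build
  (cvps K) (cvps K) (cvps_scale c) (cvps_scale_monoid c).

Definition cvps_ramify (d : nat) f := mk_cvps (ps_convergent_ramify d (cvps_conv f)).

Lemma coef_cvps_ramify d f n :
  cvps_ramify d f n = if (d %| n)%N then f (n %/ d)%N else 0.
Proof. by []. Qed.

Lemma cvps_ramify_zmod d : zmod_morphism (cvps_ramify d).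
Proof.
by move=> f g; apply/cvpsP => n /=; rewrite /ps_ramify; case: ifP; rewrite ?subr0.
Qed.
Lemma cvps_ramify_monoid d : monoid_morphism (cvps_ramify d).
Proof.
split=> [|f g]; apply/cvpsP => n /=; rewrite /ps_ramify.
  case: ifP => [/dvdnP[m ->]|dn]; last first.
    by case: n dn => //; rewrite dvdn0.
  case: d => [|d]; first by rewrite muln0 div0n.
  by rewrite mulnK// muln_eq0 orbF.
case: d => [|d].
  rewrite dvd0n /ps_mul; case: n => [|n] /=; first by rewrite !big_ord1.
  rewrite big1// => i _; rewrite /ps_ramify !dvd0n.
  case: eqP => // [->|]; first by rewrite subn0/= mulr0.
  by rewrite mul0r.
(* Coefficients up to n see only truncations, and for polynomials ramification is composition with
   ['X^(d.+1)], which is multiplicative. *)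
have -> : ps_mul (ps_ramify d.+1 f) (ps_ramify d.+1 g) n =
   (((\poly_(i < n.+1) f i) \Po 'X^(d.+1)) * ((\poly_(i < n.+1) g i) \Po 'X^(d.+1)))`_n.
  rewrite coefM; apply: eq_bigr => i _ /=; rewrite /ps_ramify.
  rewrite !coef_comp_poly_Xn// !coef_poly !ltnS.
  rewrite (leq_trans (leq_div _ _))// ?leq_ord//.
  by rewrite (leq_trans (leq_div _ _) (leq_subr _ _)).
rewrite -comp_polyM coef_comp_poly_Xn//=; case: ifP => // _.
by rewrite (@ps_mul_poly _ _ _ _ n.+1)// ltnS leq_div.
Qed.
HB.instance Definition _ d := GRing.isZmodMorphism.Build
  (cvps K) (cvps K) (cvps_ramify d) (cvps_ramify_zmod d).
HB.instance Definition _ d := GRing.isMonoidMorphism.Build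
  (cvps K) (cvps K) (cvps_ramify d) (cvps_ramify_monoid d).

Definition cvps_poly (q : {poly K}) : cvps K := mk_cvps (ps_convergent_poly q).
Lemma cvps_poly_zmod : zmod_morphism cvps_poly.
Proof. by move=> p q; apply/cvpsP => n /=; rewrite coefB. Qed.
Lemma cvps_poly_monoid : monoid_morphism cvps_poly.
Proof.
split=> [|p q]; apply/cvpsP => n /=; first by rewrite coef1.
by rewrite coefM.
Qed.
HB.instance Definition _ := GRing.isZmodMorphism.Build
  {poly K} (cvps K) cvps_poly cvps_poly_zmod.
HB.instance Definition _ := GRing.isMonoidMorphism.Build
  {poly K} (cvps K) cvps_poly cvps_poly_monoid.

Definition cvps_unramify d f := mk_cvps (ps_convergent_unramify d (cvps_conv f)).
Definition cvps_tail k f := mk_cvps (ps_convergent_tail k (cvps_conv f)).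
Definition cvps_X : cvps K := cvps_poly 'X.

Lemma coef_cvps_tail k f n : cvps_tail k f n = f (n + k)%N.
Proof. by []. Qed.

Lemma coef_cvps_Xn n k : (cvps_X ^+ k) n = (n == k)%:R.
Proof. by rewrite /cvps_X -rmorphXn/= coefXn. Qed.

Lemma coef_cvps_XnM k f n :
  (cvps_X ^+ k * f) n = if (k <= n)%N then f (n - k)%N else 0.
Proof.
rewrite coef_cvpsM; case: leqP => [kn|nk].
  rewrite (bigD1 (Ordinal (kn : (k < n.+1)%N)))//= coef_cvps_Xn eqxx mul1r.
  rewrite big1 ?addr0// => i ik; rewrite coef_cvps_Xn.
  by rewrite -[_ == k]/(i == Ordinal (kn : (k < n.+1)%N)) (negPf ik) mul0r.
rewrite big1// => i _; rewrite coef_cvps_Xn.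
by rewrite ltn_eqF ?mul0r// (leq_ltn_trans _ nk)// leq_ord.
Qed.

Lemma cvps_tailK k f : (forall i, (i < k)%N -> f i = 0) ->
  cvps_X ^+ k * cvps_tail k f = f.
Proof.
move=> f0; apply/cvpsP => n; rewrite coef_cvps_XnM /= /ps_tail.
by case: leqP => [kn|/f0->//]; rewrite subnK.
Qed.

Lemma cvps_order f : f != 0 ->
  exists n, f n != 0 /\ forall i, (i < n)%N -> f i = 0.
Proof.
move=> f0; have /ex_minnP[n fn nmin] : exists n, f n != 0.
  apply: contrapT => nf; case/eqP: f0; apply/cvpsP => n.
  by apply/eqP/negP => /negP fn; apply: nf; exists n.
exists n; split=> // i; rewrite ltnNge => ni; apply/eqP/negP => /negP fi.
by rewrite (nmin i fi) in ni.
Qed.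

(** At the sum of the two orders only one term of the convolution survives, the product of the two
    lowest nonzero coefficients. *)
Lemma cvps_mulf_eq0 f g : f * g = 0 -> f = 0 \/ g = 0.
Proof.
move=> fg0; apply: contrapT => /not_orP[/eqP/cvps_order[m [fm mmin]]].
move=> /eqP/cvps_order[n [gn nmin]].
have := congr1 (fun h : cvps K => h (m + n)%N) fg0.
rewrite coef_cvpsM coef_cvps0 (bigD1 (inord m))//= inordK; last first.
  by rewrite ltnS leq_addr.
rewrite addKn big1 ?addr0 => [/eqP|i im].
  by rewrite mulf_eq0 (negPf fm) (negPf gn).
have [/mmin->|] := ltnP i m; first by rewrite mul0r.
rewrite leq_eqVlt => /orP[/eqP mi|mi].
  by case/eqP: im; apply: val_inj; rewrite /= inordK ?mi// ltnS -mi leq_addr.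
by rewrite nmin ?mulr0// ltn_subLR ?ltn_add2r// -ltnS.
Qed.

Lemma cvps_XnI k : injective (fun f => cvps_X ^+ k * f).
Proof.
move=> f g fg; apply/cvpsP => n.
have : (cvps_X ^+ k * f) (n + k)%N = (cvps_X ^+ k * g) (n + k)%N by congr (cvps_coef _ _); exact: fg.
by rewrite !coef_cvps_XnM leq_addl addnK.
Qed.

Lemma cvps_ramify_inj d : (0 < d)%N -> injective (cvps_ramify d).
Proof.
move=> d0 f g fg; apply/cvpsP => n.
have := congr1 (fun h : cvps K => h (n * d)%N) fg.
by rewrite /= /ps_ramify dvdn_mull// mulnK.
Qed.

Lemma cvps_unramifyK d f : (0 < d)%N ->
  (forall n, ~~ (d %| n)%N -> f n = 0) -> cvps_ramify d (cvps_unramify d f) = f.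
Proof.
move=> d0 fd; apply/cvpsP => n; rewrite /= /ps_ramify /= /ps_unramify.
by case: ifPn => [/divnK->//|/fd].
Qed.

Lemma cvps_ramify_comp d e f : (0 < d)%N ->
  cvps_ramify d (cvps_ramify e f) = cvps_ramify (d * e) f.
Proof.
move=> d0; apply/cvpsP => n; rewrite /= /ps_ramify /= /ps_ramify.
case: ifPn => [/dvdnP[m ->]|dn].
  by rewrite mulnK// (mulnC m) dvdn_pmul2l// divnMl.
by rewrite ifF//; apply: contraNF dn => /(dvdn_trans _)-> //; exact: dvdn_mulr.
Qed.

Lemma cvps_ramify_Xn d k : (0 < d)%N ->
  cvps_ramify d (cvps_X ^+ k) = cvps_X ^+ (d * k).
Proof.
move=> d0; apply/cvpsP => n; rewrite coef_cvps_Xn /= /ps_ramify coef_cvps_Xn.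
case: ifPn => [/dvdnP[m ->]|dn]; first by rewrite mulnK// mulnC eqn_pmul2l.
by case: eqP dn => // ->; rewrite dvdn_mulr.
Qed.

Lemma cvps_scale_comp c c' f :
  cvps_scale c (cvps_scale c' f) = cvps_scale (c * c') f.
Proof. by apply/cvpsP => n; rewrite /= /ps_scale/= /ps_scale exprMn mulrAC mulrA. Qed.

Lemma cvps_scale_ramify c d f :
  cvps_scale c (cvps_ramify d f) = cvps_ramify d (cvps_scale (c ^+ d) f).
Proof.
apply/cvpsP => n; rewrite /= /ps_scale/= /ps_ramify/=; case: ifPn => [dn|].
  by rewrite /ps_scale -exprM (mulnC d) divnK.
by rewrite mul0r.
Qed.

Lemma cvps_scale1 f : cvps_scale 1 f = f.
Proof. by apply/cvpsP => n; rewrite /= /ps_scale expr1n mulr1. Qed.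

End CvpsRing.

(** * Majorants for recursively defined series *)

Section Majorant.
Variable K : numClosedFieldType.
Implicit Types a b x g : nat -> K.

Lemma ps_convergent_le a b :
  (forall n, `|a n| <= `|b n|) -> ps_convergent b -> ps_convergent a.
Proof.
move=> ab [r [B [r0 bB]]]; exists r, B; split=> // n.
apply: le_trans (bB n); apply: ler_sum => i _.
by rewrite ler_wpM2r// exprn_ge0// ltW.
Qed.

(** Both sides sum a_i b_j over the triangle i + j < N; the right side can be compared with a
    product of partial sums, which runs over a square. *)
Lemma sum_ps_mul a b N :
  \sum_(n < N) ps_mul a b n = \sum_(i < N) a i * \sum_(j < N - i) b j.
Proof.
elim: N => [|N IHN]; first by rewrite !big_ord0.
rewrite big_ord_recr/= IHN.
under [RHS]eq_bigr => i _.
  rewrite (subSn (leq_ord i)) big_ord_recr/= mulrDr.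
  over.
rewrite big_split/=; congr (_ + _).
by rewrite [RHS]big_ord_recr/= subnn big_ord0 mulr0 addr0.
Qed.

Lemma ps_mul_weight a b r n :
  ps_mul a b n * r ^+ n = ps_mul (fun i => a i * r ^+ i) (fun i => b i * r ^+ i) n.
Proof.
rewrite /ps_mul mulr_suml; apply: eq_bigr => i _.
by rewrite mulrACA -exprD subnKC// -ltnS.
Qed.

(* With [T_N] the partial sums of [x_n s^n], the recursion gives
   [T_(N+1) <= k (k' + T_N^2)] where [k'] is small with [s], so [T_N] stays
   below the small root of the quadratic equation. *)
Lemma ps_convergent_quadratic (k : K) x g : 0 <= k ->
  x 0%N = 0 -> g 0%N = 0 -> (forall n, 0 <= x n) -> (forall n, 0 <= g n) ->
  (forall n, x n <= k * (g n + ps_mul x x n)) ->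
  ps_convergent g -> ps_convergent x.
Proof.
move=> k0 x0 g0 xp gp xg [r [B [r0 gB]]].
have B0 : 0 <= B by have := gB 0%N; rewrite big_ord0.
have D0 : 0 < 1 + 4 * k ^+ 2 * B.
  by rewrite ltr_wpDr// !mulr_ge0// exprn_ge0.
(* Since g_0 = 0, shrinking the radius by l shrinks the bound on g to l B. The choice gives 4 k^2 (l
   B) <= 1, the condition for T = k (l B + T^2) to have real roots; 2 k l B bounds the smaller
   one. *)
pose l := (1 + 4 * k ^+ 2 * B)^-1.
have l0 : 0 < l by rewrite invr_gt0.
have l1 : l <= 1 by rewrite invf_le1// lerDl !mulr_ge0// exprn_ge0.
have lB : 4 * k ^+ 2 * (l * B) <= 1.
  by rewrite mulrCA mulrC ler_pdivrMr// mul1r lerDr.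
pose s := l * r; have s0 : 0 < s by rewrite mulr_gt0.
have gs N : \sum_(n < N) g n * s ^+ n <= l * B.
  apply: le_trans (ler_wpM2l (ltW l0) (gB N)); rewrite mulr_sumr.
  apply: ler_sum => i _; rewrite ger0_norm// mulrCA.
  case: (nat_of_ord i) => [|n]; first by rewrite g0 !mul0r.
  rewrite ler_wpM2l// exprMn ler_wpM2r ?exprn_ge0 ?(ltW r0)//.
  by rewrite -[leRHS]expr1 ler_wiXn2l// ltW.
exists s, (2 * k * (l * B)); split=> // n.
under eq_bigr do rewrite ger0_norm//.
pose y i := x i * s ^+ i.
have yp i : 0 <= y i by rewrite mulr_ge0// exprn_ge0// ltW.
have y0 : y 0%N = 0 by rewrite /y x0 mul0r.
have lB0 : 0 <= l * B by rewrite mulr_ge0// ltW.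
rewrite -/(\sum_(i < n) y i).
elim: n => [|n IHn]; first by rewrite big_ord0 mulr_ge0// mulr_ge0.
apply: (@le_trans _ _ (k * (l * B + (\sum_(i < n) y i) ^+ 2))).
  apply: (@le_trans _ _ (\sum_(i < n.+1) k * (g i * s ^+ i + ps_mul y y i))).
    apply: ler_sum => i _; rewrite /y -ps_mul_weight -mulrDl mulrA.
    by rewrite ler_wpM2r// exprn_ge0// ltW.
  rewrite -mulr_sumr big_split/= ler_wpM2l// lerD ?gs// sum_ps_mul.
  (* As y_0 = 0, the nonzero terms of the triangle i + j <= n have both indices below n, so the
     square of the previous partial sum majorizes them. *)
  rewrite big_ord_recr/= subSnn big_ord1 y0 mulr0 addr0 expr2 mulr_suml.
  apply: ler_sum => i _.
  have [->|i0] := eqVneq (val i) 0%N; first by rewrite y0 !mul0r.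
  rewrite ler_wpM2l//.
  have le : (n.+1 - i <= n)%N by rewrite leq_subLR -addn1 addnC leq_add2r lt0n.
  rewrite -[in leRHS](subnKC le) big_split_ord/= lerDl; exact: sumr_ge0.
have T0 : 0 <= \sum_(i < n) y i by apply: sumr_ge0.
apply: (@le_trans _ _ (k * (l * B + (2 * k * (l * B)) ^+ 2))).
  by rewrite ler_wpM2l// lerD2l lerXn2r ?nnegrE// mulr_ge0// mulr_ge0.
have -> : k * (l * B + (2 * k * (l * B)) ^+ 2) =
    k * (l * B) * (1 + 4 * k ^+ 2 * (l * B)) by ring.
rewrite -[leRHS]mulrA (mulrC 2) ler_wpM2l//; first by rewrite mulr_ge0.
by rewrite -[2]/(1 + 1) lerD2l.
Qed.
End Majorant.

(** * Hensel's lemma *)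

Section PolynomialNorm.
Variable K : numClosedFieldType.
Implicit Types p q : {poly K}.

(** This norm is submultiplicative, which turns the recursion of Hensel's lemma into a scalar
    quadratic inequality. *)
Definition poly_norm p : K := \sum_(i < size p) `|p`_i|.

Lemma poly_norm_wide n p : (size p <= n)%N -> poly_norm p = \sum_(i < n) `|p`_i|.
Proof.
move=> pn; rewrite -(subnKC pn) big_split_ord/= [X in _ + X]big1 ?addr0//.
by move=> i _; rewrite nth_default ?normr0// leq_addr.
Qed.

Lemma poly_norm_ge0 p : 0 <= poly_norm p.
Proof. exact: sumr_ge0. Qed.

Lemma coef_le_poly_norm p i : `|p`_i| <= poly_norm p.
Proof.
have [ip|pi] := ltnP i (size p); last by rewrite nth_default// normr0 poly_norm_ge0.
by rewrite /poly_norm (bigD1 (Ordinal ip))//= lerDl sumr_ge0.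
Qed.

Lemma poly_normD p q : poly_norm (p + q) <= poly_norm p + poly_norm q.
Proof.
pose n := maxn (size p) (size q).
rewrite !(@poly_norm_wide n) ?size_polyD ?leq_maxl ?leq_maxr// -big_split/=.
by apply: ler_sum => i _; rewrite coefD ler_normD.
Qed.

Lemma poly_norm0 : poly_norm 0 = 0.
Proof. by rewrite /poly_norm size_poly0 big_ord0. Qed.

Lemma poly_norm_sum n (F : nat -> {poly K}) :
  poly_norm (\sum_(i < n) F i) <= \sum_(i < n) poly_norm (F i).
Proof.
elim: n => [|n IHn]; first by rewrite !big_ord0 poly_norm0.
rewrite !big_ord_recr/=; apply: le_trans (poly_normD _ _) _.
by rewrite lerD2r.
Qed.

Lemma poly_normZ c p : poly_norm (c *: p) = `|c| * poly_norm p.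
Proof.
rewrite !(@poly_norm_wide (size p)) ?size_scale_leq// mulr_sumr.
by apply: eq_bigr => i _; rewrite coefZ normrM.
Qed.

Lemma poly_normN p : poly_norm (- p) = poly_norm p.
Proof. by rewrite -scaleN1r poly_normZ normrN1 mul1r. Qed.

Lemma poly_norm_XnM n p : poly_norm ('X^n * p) = poly_norm p.
Proof.
rewrite (@poly_norm_wide (n + size p)) ?size_polyMleq //; last first.
  apply: leq_trans (size_polyMleq _ _) _; rewrite size_polyXn.
  by rewrite addSn.
rewrite big_split_ord/= big1 ?add0r => [|i _]; last first.
  by rewrite coefXnM ltn_ord normr0.
by apply: eq_bigr => i _; rewrite coefXnM ltnNge leq_addr/= addKn.
Qed.

Lemma poly_normM p q : poly_norm (p * q) <= poly_norm p * poly_norm q.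
Proof.
have -> : p * q = \sum_(i < size p) p`_i *: ('X^i * q).
  rewrite -[X in X * _]coefK poly_def.
  by rewrite mulr_suml; apply: eq_bigr => i _; rewrite scalerAl.
apply: le_trans (poly_norm_sum _ (fun i => p`_i *: ('X^i * q))) _.
rewrite mulr_suml; apply: ler_sum => i _.
by rewrite poly_normZ poly_norm_XnM.
Qed.

End PolynomialNorm.

Section Hensel.
Variable K : numClosedFieldType.

(* Solving [A * g2 + B * g1 = H] linearly, one monomial of [H] at a time, makes
   the solution bounded in terms of [H]. *)
Lemma bezout_bounded (g1 g2 : {poly K}) :
  g1 \is monic -> g2 \is monic -> coprimep g1 g2 ->
  exists (T1 T2 : {poly K} -> {poly K}) (k : K), [/\ 0 <= k,
    forall H : {poly K}, (size (T1 H) < size g1)%N,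
    forall H : {poly K}, (size (T2 H) < size g2)%N,
    forall H : {poly K}, (size H < size (g1 * g2)%R)%N -> T1 H * g2 + T2 H * g1 = H
    & forall H : {poly K}, poly_norm (T1 H) + poly_norm (T2 H) <= k * poly_norm H].
Proof.
move=> m1 m2 /Bezout_eq1_coprimepP[[u v] /= uv1].
have g10 : g1 != 0 by exact: monic_neq0.
have g20 : g2 != 0 by exact: monic_neq0.
(* Multiplying u g1 + v g2 = 1 by X^i solves the equation without degree bounds. After reduction
   modulo g1 and g2 the error is a multiple of g1 g2 of smaller degree, hence zero. *)
pose a i := (v * 'X^i) %% g1.
pose b i := (u * 'X^i) %% g2.
have sa i : (size (a i) < size g1)%N by rewrite ltn_modp.
have sb i : (size (b i) < size g2)%N by rewrite ltn_modp.
have sg : size (g1 * g2) = (size g1 + size g2).-1 by rewrite size_mul.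
have s10 : (0 < size g1)%N by rewrite size_poly_gt0.
have s20 : (0 < size g2)%N by rewrite size_poly_gt0.
have ab i : (i < (size (g1 * g2)%R).-1)%N -> a i * g2 + b i * g1 = 'X^i.
  move=> ilt.
  have : (g1 * g2) %| ('X^i - (a i * g2 + b i * g1)).
    have -> : 'X^i - (a i * g2 + b i * g1) =
        ((v * 'X^i) %/ g1 + (u * 'X^i) %/ g2) * (g1 * g2).
      rewrite -[X in X - _]mul1r -uv1.
      have h1 := divp_eq (v * 'X^i) g1; have h2 := divp_eq (u * 'X^i) g2.
      rewrite (_ : (u * g1 + v * g2) * 'X^i = (v * 'X^i) * g2 + (u * 'X^i) * g1);
        last by ring.
      by rewrite [in LHS]h1 [in LHS]h2 -/(a i) -/(b i); ring.
    exact: dvdp_mull.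
  move=> dv; apply/esym/eqP; rewrite -subr_eq0; apply: contraT => nz.
  have := dvdp_leq nz dv; rewrite leqNgt => /negP[].
  rewrite (leq_ltn_trans (size_polyD _ _))// gtn_max size_polyN size_polyXn.
  rewrite (leq_ltn_trans (size_polyD _ _)) ?gtn_max/=; last first.
    apply/andP; split; apply: (leq_ltn_trans (size_polyMleq _ _)); rewrite sg.
      by move: (sa i) s10 s20; move: (size (a i)) (size g1) (size g2) => *; lia.
    by move: (sb i) s10 s20; move: (size (b i)) (size g1) (size g2) => *; lia.
  by move: ilt; move: (size (g1 * g2)) => s; rewrite ?andbT => *; lia.
pose d := (size (g1 * g2)%R).-1.
exists (fun H => \sum_(i < d) H`_i *: a i), (fun H => \sum_(i < d) H`_i *: b i),
  (\sum_(i < d) (poly_norm (a i) + poly_norm (b i))).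
have small (h : nat -> {poly K}) (g H : {poly K}) : (0 < size g)%N ->
    (forall i, size (h i) < size g)%N -> (size (\sum_(i < d) H`_i *: h i)%R < size g)%N.
  move=> g0 hg; elim/big_ind: _ => [|p q pg qg|i _]; first by rewrite size_poly0.
    by rewrite (leq_ltn_trans (size_polyD _ _))// gtn_max pg.
  by rewrite (leq_ltn_trans (size_scale_leq _ _)).
split.
- by apply: sumr_ge0 => i _; rewrite addr_ge0 ?poly_norm_ge0.
- by move=> H; apply: small.
- by move=> H; apply: small.
- move=> H Hd; rewrite !mulr_suml -big_split/=.
  rewrite -[RHS]coefK poly_def (big_ord_widen d (fun i => H`_i *: 'X^i)); last first.
    by rewrite /d; case: (size (g1 * g2)) Hd.
  rewrite [RHS]big_mkcond/=; apply: eq_bigr => i _.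
  rewrite -!scalerAl -scalerDr ab//; case: ltnP => // Hi.
  by rewrite nth_default// scale0r.
- move=> H; rewrite mulr_suml.
  have bound (h : nat -> {poly K}) :
      poly_norm (\sum_(i < d) H`_i *: h i) <= \sum_(i < d) poly_norm (h i) * poly_norm H.
    apply: le_trans (poly_norm_sum _ (fun i => H`_i *: h i)) _.
    apply: ler_sum => i _; rewrite poly_normZ mulrC ler_wpM2l ?poly_norm_ge0//.
    exact: coef_le_poly_norm.
  apply: le_trans (lerD (bound a) (bound b)) _.
  by rewrite -big_split/=; apply: ler_sum => i _; rewrite mulrDl.
Qed.

(** The coefficient of z1^n when [G] is read as a power series in z1 over the polynomials in z2, the
    order in which Hensel's recursion proceeds. *)
Definition poly_slice (n : nat) (G : {poly cvps K}) : {poly K} :=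
  \poly_(i < size G) (G`_i : cvps K) n.

Lemma coef_poly_slice n (G : {poly cvps K}) i : (poly_slice n G)`_i = (G`_i : cvps K) n.
Proof.
by rewrite coef_poly; case: ltnP => // Gi; rewrite nth_default.
Qed.

Lemma poly_slice_monic0 n (G : {poly cvps K}) : (0 < n)%N ->
  G \is monic -> (size (poly_slice n G) < size G)%N.
Proof.
move=> n0 Gm; have G0 : (0 < size G)%N by rewrite size_poly_gt0 monic_neq0.
rewrite -(prednK G0) ltnS; apply/leq_sizeP => j Gj; rewrite coef_poly_slice.
move: Gj; rewrite leq_eqVlt => /orP[/eqP <-|Gj]; last first.
  by rewrite nth_default//; move: Gj; case: (size G) G0.
by have /monicP := Gm; rewrite /lead_coef => ->; case: n n0.
Qed.

Lemma ps_convergent_poly_norm_slice (G : {poly cvps K}) :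
  ps_convergent (fun n => poly_norm (poly_slice n G)).
Proof.
have abs (f : cvps K) : ps_convergent (fun n => `|f n|).
  by apply: ps_convergent_le (cvps_conv f) => n; rewrite normr_id.
apply: ps_convergent_le (cvps_conv (\sum_(i < size G) mk_cvps (abs G`_i))) => n.
rewrite coef_cvps_sum/= !ger0_norm ?poly_norm_ge0 ?sumr_ge0//.
rewrite (@poly_norm_wide _ (size G)) ?size_poly//.
by apply: ler_sum => i _; rewrite coef_poly_slice.
Qed.

End Hensel.

(** Hensel's recursion uses all earlier values; building the finite prefixes as lists makes it
    structural. *)
Lemma course_of_values (T : Type) (x0 : T) (step : nat -> (nat -> T) -> T) :
  (forall n u v, (forall i, (i < n)%N -> u i = v i) -> step n u = step n v) ->
  exists u : nat -> T, forall n, u n = step n u.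
Proof.
move=> stepE.
pose prefix := fix prefix n := if n is m.+1
  then rcons (prefix m) (step m (nth x0 (prefix m))) else [::].
have size_prefix n : size (prefix n) = n by elim: n => //= n IHn; rewrite size_rcons IHn.
have nth_prefix m n i : (i < m)%N -> (m <= n)%N -> nth x0 (prefix n) i = nth x0 (prefix m) i.
  move=> im; elim: n => [|n IHn]; first by rewrite leqn0 => /eqP m0; rewrite m0 in im.
  rewrite leq_eqVlt => /orP[/eqP->//|mn].
  by rewrite /= nth_rcons size_prefix (leq_trans im mn) IHn.
exists (fun n => nth x0 (prefix n.+1) n) => n.
rewrite [LHS]/= nth_rcons size_prefix ltnn eqxx; apply: stepE => i ni.
exact: nth_prefix.
Qed.

Section HenselFactorization.
Variable K : numClosedFieldType.

(** With G1 = g1 + sum a_n z1^n and G2 = g2 + sum b_n z1^n, the coefficient of z1^n for n > 0 gives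
    a_n g2 + b_n g1 in terms of [G] and of earlier a_i, b_i. The bounded solution operators keep the
    degrees below those of g1 and g2, so G1 stays monic, and make the norms satisfy the quadratic
    majorant inequality. *)
Theorem hensel (G : {poly cvps K}) (g1 g2 : {poly K}) :
  G \is monic -> g1 \is monic -> g2 \is monic -> coprimep g1 g2 ->
  map_poly (@cvps_const_coef K) G = g1 * g2 ->
  exists G1 G2 : {poly cvps K},
    [/\ G1 \is monic, size G1 = size g1 & G = G1 * G2].
Proof.
move=> Gm m1 m2 cop G0.
have [T1 [T2 [k [k0 sT1 sT2 Teq Tbound]]]] := bezout_bounded m1 m2 cop.
have sG : size G = size (g1 * g2).
  rewrite -G0 size_map_poly_id0// (monicP Gm) rmorph1.
  exact: oner_neq0.
pose conv (u : nat -> {poly K} * {poly K}) n :=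
  \sum_(i < n.+1 | (0 < i < n)%N) (u i).1 * (u (n - i)%N).2.
pose H u n := poly_slice n G - conv u n.
(* Index 0 holds zero rather than (g1, g2), so that the majorized sequence vanishes at 0; g1 and g2
   are put back in [A] and [B]. *)
have [|u uE] := @course_of_values _ (0, 0)
    (fun n u => if n == 0%N then (0, 0) else (T1 (H u n), T2 (H u n))).
  move=> n u v uv; case: eqP => // _.
  rewrite (_ : H u n = H v n)//; congr (_ - _).
  apply: eq_bigr => i /andP[i0 ni]; rewrite !uv//.
  by rewrite ltn_subrL i0 (leq_trans _ ni).
have u0 : u 0%N = (0, 0) by rewrite uE eqxx.
pose a n := (u n).1; pose b n := (u n).2.
have convE n : (0 < n)%N -> conv u n = \sum_(i < n.+1) a i * b (n - i)%N.
  move=> n0; rewrite /conv big_mkcond/=; apply: eq_bigr => i _.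
  case: ifP => //; have := leq_ord i; rewrite leq_eqVlt => /orP[/eqP->|->].
    by rewrite subnn /b u0/= mulr0.
  by rewrite andbT lt0n => /negbFE/eqP->; rewrite /a u0/= mul0r.
have sa n : (size (a n) < size g1)%N.
  rewrite /a uE; case: eqP => _ //=.
  by rewrite size_poly0 size_poly_gt0 monic_neq0.
have sb n : (size (b n) < size g2)%N.
  rewrite /b uE; case: eqP => _ //=.
  by rewrite size_poly0 size_poly_gt0 monic_neq0.
have sH n : (0 < n)%N -> (size (H u n) < size (g1 * g2)%R)%N.
  move=> n0; rewrite (leq_ltn_trans (size_polyD _ _))// size_polyN gtn_max.
  rewrite -sG poly_slice_monic0//= sG.
  have : (0 < size (g1 * g2)%R)%N by rewrite size_poly_gt0 mulf_neq0// monic_neq0.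
  rewrite /conv; elim/big_ind : _ => [|p q pg qg g0|i _ _]; first by rewrite size_poly0.
    by rewrite (leq_ltn_trans (size_polyD _ _))// gtn_max pg// qg.
  rewrite (size_mul (monic_neq0 m1) (monic_neq0 m2)); apply: leq_ltn_trans (size_polyMleq _ _) _.
  move: (sa i) (sb (n - i)%N); rewrite /a /b.
  by move: (size _) (size g1) (size _) (size g2) => *; lia.
have abE n : (0 < n)%N ->
    a n * g2 + b n * g1 + \sum_(i < n.+1) a i * b (n - i)%N = poly_slice n G.
  move=> n0; rewrite -convE//.
  have [-> ->] : a n = T1 (H u n) /\ b n = T2 (H u n).
    by rewrite /a /b uE gtn_eqF.
  by rewrite Teq ?sH// subrK.
pose x n := poly_norm (a n) + poly_norm (b n).
pose g n := if n == 0%N then 0 else poly_norm (poly_slice n G).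
have x_ge0 n : 0 <= x n by rewrite addr_ge0 ?poly_norm_ge0.
have xconv : ps_convergent x.
  apply: (@ps_convergent_quadratic _ k x g) => //.
  - by rewrite /x /a /b u0 /= poly_norm0 addr0.
  - by move=> n; rewrite /g; case: eqP => // _; exact: poly_norm_ge0.
  - move=> n; rewrite /g; case: eqP => [->|/eqP n0].
      rewrite /x /a /b u0 /= poly_norm0 addr0 add0r mulr_ge0// sumr_ge0// => i _.
      by rewrite mulr_ge0 ?addr_ge0 ?poly_norm_ge0.
    rewrite /x /a /b uE (negPf n0)/=; apply: le_trans (Tbound _) _.
    rewrite ler_wpM2l// (le_trans (poly_normD _ _))// lerD2l poly_normN.
    rewrite convE ?lt0n//.
    apply: le_trans (poly_norm_sum _ (fun i => a i * b (n - i)%N)) _.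
    apply: ler_sum => i _; apply: le_trans (poly_normM _ _) _.
    by rewrite ler_pM ?poly_norm_ge0// /x ?lerDl ?lerDr poly_norm_ge0.
  - apply: ps_convergent_le (ps_convergent_poly_norm_slice G) => n.
    by rewrite /g; case: eqP => // _; rewrite normr0.
pose A n := a n + (if n == 0%N then g1 else 0).
pose B n := b n + (if n == 0%N then g2 else 0).
have ABE n : \sum_(i < n.+1) A i * B (n - i)%N = poly_slice n G.
  case: (posnP n) => [->|n0].
    rewrite big_ord1 /A /B /a /b u0/= !add0r -G0.
    by apply/polyP => i; rewrite !coef_poly_slice.
  rewrite -abE//.
  pose al i := if i == 0%N then g1 else 0 : {poly K}.
  pose be i := if i == 0%N then g2 else 0 : {poly K}.
  transitivity (\sum_(i < n.+1) (a i * be (n - i)%N + al i * B (n - i)%N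
                                  + a i * b (n - i)%N)).
    apply: eq_bigr => i _; rewrite {1}/A -/(al i) /B -/(be _); ring.
  rewrite !big_split/=; congr (_ + _ + _).
    rewrite big_ord_recr/= subnn /be eqxx big1 ?add0r// => i _.
    by rewrite gtn_eqF ?mulr0// subn_gt0.
  rewrite big_ord_recl/= subn0 /al /= big1 ?addr0 => [|i _]; last by rewrite mul0r.
  by rewrite /B gtn_eqF// addr0 mulrC.
have sA n : (size (A n) <= size g1)%N.
  rewrite (leq_trans (size_polyD _ _))// geq_max ltnW//=.
  by case: eqP; rewrite ?size_poly0.
have sB n : (size (B n) <= size g2)%N.
  rewrite (leq_trans (size_polyD _ _))// geq_max ltnW//=.
  by case: eqP; rewrite ?size_poly0.
have convP (c : nat -> {poly K}) (h : {poly K}) i :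
    (forall n, poly_norm (c n) <= x n) ->
    ps_convergent (fun n => (c n + (if n == 0%N then h else 0))`_i).
  move=> cx; apply: ps_convergent_le
    (cvps_conv (mk_cvps xconv + mk_cvps (ps_convergent_poly (poly_norm h)%:P))) => n.
  rewrite coefD/= coefC (le_trans (ler_normD _ _))//.
  rewrite [leRHS]ger0_norm; last by rewrite addr_ge0//; case: ifP; rewrite ?poly_norm_ge0.
  apply: lerD; first exact: le_trans (coef_le_poly_norm _ _) (cx n).
  by case: eqP => _; rewrite ?coef0 ?normr0// coef_le_poly_norm.
have convA i : ps_convergent (fun n => (A n)`_i).
  by apply: convP => n; rewrite lerDl poly_norm_ge0.
have convB i : ps_convergent (fun n => (B n)`_i).
  by apply: convP => n; rewrite lerDr poly_norm_ge0.
pose G1 := \poly_(i < size g1) mk_cvps (convA i).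
pose G2 := \poly_(i < size g2) mk_cvps (convB i).
have cG1 i n : (G1`_i : cvps K) n = (A n)`_i.
  rewrite coef_poly; case: ltnP => // gi.
  by rewrite nth_default ?(leq_trans (sA n)).
have cG2 i n : (G2`_i : cvps K) n = (B n)`_i.
  rewrite coef_poly; case: ltnP => // gi.
  by rewrite nth_default ?(leq_trans (sB n)).
have g1_gt0 : (0 < size g1)%N by rewrite size_poly_gt0 monic_neq0.
have lead : G1`_(size g1).-1 = 1.
  apply/cvpsP => n; rewrite cG1 coefD nth_default ?add0r; last first.
    by rewrite -ltnS prednK.
  rewrite coef_cvps1; case: eqP => _; last by rewrite coef0.
  by have /monicP := m1; rewrite /lead_coef => ->.
have sG1 : size G1 = size g1.
  rewrite /G1 size_poly_eq//; have := lead; rewrite coef_poly prednK// leqnn => ->.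
  exact: oner_neq0.
exists G1, G2; split=> //; first by apply/monicP; rewrite /lead_coef sG1.
apply/polyP => i; apply/cvpsP => n.
rewrite -coef_poly_slice -ABE coef_sum coefM coef_cvps_sum.
under eq_bigr do rewrite coefM.
rewrite exchange_big; apply: eq_bigr => j _.
by rewrite coef_cvpsM; apply: eq_bigr => l _; rewrite cG1 cG2.
Qed.
End HenselFactorization.

(** * Puiseux's theorem *)

(** The Tschirnhaus shift. The last formula tells which [c] removes the subleading coefficient, and
    also identifies the centre of a pure power of a linear polynomial. *)
Lemma comp_poly_XsubC (S : comNzRingType) (F : {poly S}) (c : S) (d : nat) :
  F \is monic -> size F = d.+2 ->
  [/\ F \Po ('X - c%:P) \is monic, size (F \Po ('X - c%:P)) = d.+2
    & (F \Po ('X - c%:P))`_d = F`_d - c *+ d.+1].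
Proof.
move=> Fm sF; set G := _ \Po _.
have powE m : ('X - c%:P) ^+ m = \prod_(x <- nseq m c) ('X - x%:P).
  by rewrite big_nseq iter_mulr_1.
have sub n : (('X - c%:P) ^+ n.+1)`_n = - (c *+ n.+1).
  have := @coefPn_prod_XsubC _ (nseq n.+1 c).
  by rewrite size_nseq -powE big_nseq iter_addr_0 => ->.
have lead n : (('X - c%:P) ^+ n)`_n = 1.
  have /monicP := monic_exp n (monicXsubC c).
  by rewrite /lead_coef size_exp_XsubC.
have big n m : (n < m)%N -> (('X - c%:P) ^+ n)`_m = 0.
  by move=> nm; rewrite nth_default// size_exp_XsubC.
have FD : F`_d.+1 = 1 by have /monicP := Fm; rewrite /lead_coef sF.
have GE j : G`_j = \sum_(i < d) F`_i * (('X - c%:P) ^+ i)`_j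
    + F`_d * (('X - c%:P) ^+ d)`_j + (('X - c%:P) ^+ d.+1)`_j.
  rewrite /G comp_polyE sF coef_sum !big_ord_recr/= FD scale1r coefZ.
  by congr (_ + _ + _); apply: eq_bigr => i _; rewrite coefZ.
have Gbig j : (d < j)%N -> G`_j = (('X - c%:P) ^+ d.+1)`_j.
  move=> dj; rewrite GE (big _ _ dj) mulr0 addr0 big1 ?add0r// => i _.
  by rewrite big ?mulr0// (ltn_trans (ltn_ord i)).
have GD : G`_d.+1 = 1 by rewrite Gbig// lead.
have sG : size G = d.+2.
  apply/eqP; rewrite eqn_leq; apply/andP; split.
    by apply/leq_sizeP => j dj; rewrite Gbig ?(ltnW dj)// big.
  by rewrite ltnNge; apply/negP => /leq_sizeP/(_ _ (leqnn _)); rewrite GD => /eqP; rewrite oner_eq0.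
split=> //; first by apply/monicP; rewrite /lead_coef sG.
by rewrite GE lead mulr1 sub big1 ?add0r// => i _; rewrite big ?mulr0.
Qed.

Section Puiseux.
Variable K : numClosedFieldType.
Implicit Types F G : {poly cvps K}.

(* The substitution z1 = t^b, z2 = t^a Y, where a / b is the least slope of the
   Newton polygon. *)
Lemma newton_polygon_reduction F (d : nat) : F \is monic -> size F = d.+2 ->
  F`_d = 0 -> F != 'X^(d.+1) ->
  exists (a b : nat) G, [/\ (0 < b)%N, G \is monic, size G = d.+2, G`_d = 0 &
    (exists2 i, (i < d.+1)%N & (G`_i : cvps K) 0%N != 0) /\
    forall n f, (0 < n)%N -> root (map_poly (cvps_ramify n) G) f ->
      root (map_poly (cvps_ramify (n * b)) F) (cvps_X K ^+ (n * a) * f)].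
Proof.
move=> Fm sF Fd FX; pose D := d.+1.
have FD : F`_D = 1 by have /monicP := Fm; rewrite /lead_coef sF.
have /choice[e eP] : forall i, exists n, F`_i != 0 ->
    (F`_i : cvps K) n != 0 /\ forall j, (j < n)%N -> (F`_i : cvps K) j = 0.
  move=> i; have [->|/cvps_order[n nP]] := eqVneq F`_i 0; last by exists n.
  by exists 0%N; rewrite eqxx.
have [i1 Fi1] : exists i : 'I_D, F`_i != 0.
  apply: contrapT => nF; case/eqP: FX; apply/polyP => i; rewrite coefXn.
  case: (ltngtP i D) => [iD|iD|->//].
    by apply/eqP/negP => /negP Fi; apply: nF; exists (Ordinal iD).
  by rewrite nth_default// sF.
(* The rational slope e_i / (D - i) times D!, an integer because D - i divides D!; minimizing it
   stays within the natural numbers. *)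
pose slope (i : 'I_D) := (e i * (D`! %/ (D - i)))%N.
have [i0 Fi0 i0min] := @arg_minnP _ i1 (fun i : 'I_D => F`_i != 0) slope Fi1.
pose b := (D - i0)%N; pose a := e i0.
have b0 : (0 < b)%N by rewrite subn_gt0.
have ineq (i : 'I_D) : F`_i != 0 -> (a * (D - i) <= e i * b)%N.
  move=> /i0min; rewrite /slope -/a -/b.
  have divf (j : 'I_D) : (D`! %/ (D - j) * (D - j) = D`!)%N.
    by rewrite divnK// dvdn_fact// subn_gt0 ltn_ord leq_subr.
  have := divf i; have := divf i0; rewrite -/b.
  move: (D`! %/ b)%N (D`! %/ (D - i))%N (D - i)%N (fact_gt0 D) => x y m N0 xb ym le.
  rewrite -(leq_pmul2r N0) -{1}xb -ym.
  by rewrite mulnACA [leqRHS]mulnACA (mulnC b) leq_mul.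
pose Fb i : cvps K := cvps_ramify b F`_i.
(* Minimality of the slope says that F_i(t^b) has order at least a (D - i), so that t^(a D) can be
   divided out of F(t^b, t^a Y). *)
have FbK i : cvps_X K ^+ (a * (D - i)) * cvps_tail (a * (D - i)) (Fb i) = Fb i.
  apply: cvps_tailK => j jlt; rewrite coef_cvps_ramify; case: ifP => // bj.
  have iD : (i < D)%N by rewrite -subn_gt0; move: jlt; case: (D - i)%N; rewrite ?muln0.
  have [->//|Fi] := eqVneq F`_i 0.
  apply: (eP i Fi).2; rewrite ltn_divLR//.
  exact: leq_trans jlt (ineq (Ordinal iD) Fi).
pose G := \poly_(i < D.+1) cvps_tail (a * (D - i)) (Fb i).
have cG i : (i <= D)%N -> G`_i = cvps_tail (a * (D - i)) (Fb i).
  by move=> iD; rewrite coef_poly ltnS iD.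
have GD : G`_D = 1.
  rewrite cG// subnn muln0; apply: (@cvps_XnI _ 0).
  have := FbK D; rewrite subnn muln0 => ->.
  by rewrite /Fb FD rmorph1 expr0 mul1r.
have sG : size G = d.+2.
  by rewrite size_poly_eq//= -cG// GD oner_neq0.
exists a, b, G; split=> //.
- by apply/monicP; rewrite /lead_coef sG.
- rewrite cG; last exact: leqnSn.
  apply: (@cvps_XnI _ (a * (D - d))); rewrite /= FbK /Fb Fd rmorph0.
  by rewrite mulr0.
split.
  (* At the minimizing index the bound on the order is attained, so the quotient has a nonzero
     constant term. *)
  exists i0; first exact: ltn_ord.
  rewrite (cG i0 (ltnW (ltn_ord i0))) coef_cvps_tail add0n /Fb coef_cvps_ramify.
  rewrite -/b dvdn_mull// mulnK//; exact: (eP i0 Fi0).1.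
move=> n f n0; rewrite !rootE !horner_coef.
have sm m (H : {poly cvps K}) : H \is monic -> size (map_poly (cvps_ramify m) H) = size H.
  move=> Hm; rewrite size_map_poly_id0// (monicP Hm) rmorph1; exact: oner_neq0.
have Gm : G \is monic by apply/monicP; rewrite /lead_coef sG.
rewrite !sm// sF sG => /eqP G0; apply/eqP.
transitivity (cvps_X K ^+ (n * a * D) *
   (\sum_(i < d.+2) (map_poly (cvps_ramify n) G)`_i * f ^+ i)); last by rewrite G0 mulr0.
rewrite mulr_sumr; apply: eq_bigr => i _; rewrite !coef_map/=.
rewrite -cvps_ramify_comp// -/(Fb i) -FbK rmorphM/= cvps_ramify_Xn//.
have iD : (i <= D)%N by rewrite -ltnS.
rewrite cG// exprMn -exprM mulnA.
rewrite mulrACA -exprD -mulnDr subnK// mulrA.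
Qed.

(** Induction on the degree: Hensel's lemma lifts one of the coprime factors to a factor of smaller
    degree. A single root is enough, since for irreducible [F] the others are obtained from it by
    rotating t. *)
Theorem puiseux_root F : F \is monic -> (1 < size F)%N ->
  exists n f, (0 < n)%N /\ root (map_poly (cvps_ramify n) F) f.
Proof.
have [m] : exists m, (size F <= m)%N by exists (size F).
elim: m F => [|m IHm] F sFm Fm s1.
  by move: s1; rewrite ltnNge (leq_trans sFm).
have [d sF] : exists d, size F = d.+2 
  by exists (size F).-2; move: s1; case: (size F) => [|[|e]].
(* Once the subleading coefficient is removed, the polynomial at t = 0 is not
   a power of a linear one, so it has two coprime factors. *)
pose c := cvps_poly (d.+1%:R^-1)%:P * F`_d.
have [Hm sH Hd] := comp_poly_XsubC c Fm sF.
set H := F \Po _ in Hm sH Hd.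
have {}Hd : H`_d = 0.
  rewrite Hd /c -mulrnAl -rmorphMn/= -polyCMn -[_ *+ _]mulr_natr.
  by rewrite mulVf ?pnatr_eq0// polyC1 rmorph1 mul1r subrr.
suff [n [f [n0 rf]]] : exists n f, (0 < n)%N /\ root (map_poly (cvps_ramify n) H) f.
  exists n, (f - cvps_ramify n c); split=> //.
  move: rf; rewrite /H map_comp_poly/= rmorphB/= map_polyX map_polyC/=.
  by rewrite !rootE horner_comp !hornerE.
have [HX|HX] := eqVneq H 'X^(d.+1).
  by exists 1%N, 0; split=> //; rewrite HX map_polyXn rootE hornerXn expr0n.
have [a [b [G [b0 Gm sG Gd [[i id Gi] Groot]]]]] := newton_polygon_reduction Hm sH Hd HX.
suff [n [f [n0 rf]]] : exists n f, (0 < n)%N /\ root (map_poly (cvps_ramify n) G) f.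
  exists (n * b)%N, (cvps_X K ^+ (n * a) * f); split; first by rewrite muln_gt0 n0.
  exact: Groot.
pose g := map_poly (@cvps_const_coef K) G.
have gm : g \is monic by apply: monic_map.
have sg : size g = d.+2.
  rewrite size_map_poly_id0// (monicP Gm) rmorph1; exact: oner_neq0.
have [x gx] : exists x, root g x by apply/closed_rootP; rewrite sg.
have [k [h hx gE]] := multiplicity_XsubC g x.
rewrite monic_neq0//= in hx.
have hm : h \is monic.
  by move: gm; rewrite gE monicMr ?monic_exp ?monicXsubC.
have k0 : (0 < k)%N.
  by case: k gE => // gE; move: gx hx; rewrite gE mulr1 => ->.
(* A constant cofactor would give g = (X - x)^(d+1). Its subleading coefficient -(d+1) x vanishes,
   so x = 0 and all lower coefficients vanish, against [Gi]. *)
have h1 : (1 < size h)%N.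
  rewrite ltnNge; apply/negP => /size1_polyC hC.
  have {}hC : h = 1.
    by move: hm; rewrite hC monicE lead_coefC => /eqP ->.
  have kd : k = d.+1 by move: sg; rewrite gE hC mul1r size_exp_XsubC => -[].
  have {}gE : g = ('X - x%:P) ^+ d.+1 by rewrite gE hC mul1r kd.
  have [_ _] := comp_poly_XsubC x (monicXn _ d.+1) (size_polyXn _ d.+1).
  rewrite comp_Xn_poly coefXn -gE ltn_eqF// coef_map/= Gd rmorph0 add0r.
  move=> /esym/eqP; rewrite oppr_eq0 mulrn_eq0/= => /eqP x0.
  move: Gi; rewrite -[X in X != 0]/(cvps_const_coef G`_i) -coef_map -/g gE x0.
  by rewrite subr0 coefXn ltn_eqF// eqxx.
have [|||G1 [G2 [G1m sG1 GE]]] := @hensel _ G (('X - x%:P) ^+ k) h Gm _ hm.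
- by rewrite monic_exp// monicXsubC.
- by apply: coprimep_expl; rewrite coprimep_sym coprimep_XsubC.
- by rewrite -/g gE mulrC.
have sk : (k + size h = d.+2)%N.
  move: sg; rewrite gE (size_monicM hm (monic_neq0 (monic_exp k (monicXsubC x)))).
  by rewrite size_exp_XsubC addnS/= addnC.
have [||n [f [n0 rf]]] := IHm G1 _ G1m.
- by move: sFm; rewrite sG1 size_exp_XsubC sF -sk => ?; lia.
- by rewrite sG1 size_exp_XsubC.
exists n, f; split=> //.
by rewrite GE rmorphM rootE hornerM (eqP rf) mul0r.
Qed.

End Puiseux.

(** Linear factors are divided out one at a time; without zero divisors, the remaining distinct
    roots are roots of the quotient. *)
Lemma dvd_prod_XsubC (S : comNzRingType) (F : {poly S}) (s : seq S) :
  (forall x y : S, x * y = 0 -> x = 0 \/ y = 0) -> uniq s -> all (root F) s ->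
  exists Q, F = Q * \prod_(x <- s) ('X - x%:P).
Proof.
move=> domS; elim: s F => [|x s IHs] F /=.
  by move=> _ _; exists F; rewrite big_nil mulr1.
move=> /andP[xs us] /andP[/factor_theorem[G FG] Fs].
have [|Q GQ] := IHs G us; last by exists Q; rewrite FG GQ big_cons mulrAC mulrA.
apply/allP => y ys; have := allP Fs y ys.
rewrite FG !rootE hornerM hornerXsubC => /eqP/domS[->//|/eqP].
by rewrite subr_eq0 => /eqP yx; rewrite -yx ys in xs.
Qed.

Lemma ring_unit_monic (S : comNzRingType) (F : {poly S}) :
  F \is monic -> ring_unit F -> F = 1.
Proof.
move=> Fm [G FG]; have G0 : G != 0.
  by apply/eqP => G0; move: FG; rewrite G0 mulr0 => /esym/eqP; rewrite oner_eq0.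
have F0 : (0 < size F)%N by rewrite size_poly_gt0 monic_neq0.
have sG : (0 < size G)%N by rewrite size_poly_gt0.
have := size_monicM Fm G0; rewrite FG size_poly1.
move=> sFG; have sF : (size F <= 1)%N.
  by move: sFG F0 sG; case: (size F) (size G) => [|[|a]] [|b]//=; rewrite addnS.
have FC := size1_polyC sF; move: Fm; rewrite FC monicE lead_coefC => /eqP ->.
by [].
Qed.

Lemma prod_shift_cyclic (S : comNzRingType) (n : nat) (f : nat -> S) :
  f n = f 0%N -> \prod_(i < n) f i.+1 = \prod_(i < n) f i.
Proof.
case: n => [|n] fn; first by rewrite !big_ord0.
by rewrite [RHS]big_ord_recl big_ord_recr/= mulrC fn.
Qed.

Section IrreduciblePuiseux.
Variables (K : numClosedFieldType) (w : nat -> K).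
Hypothesis w_prim : forall n, (0 < n)%N -> n.-primitive_root (w n).

(** Rotation by w multiplies the coefficient of t^n by w^n, so invariance kills every n that is not
    a multiple of d. *)
Lemma ramified_of_invariant (d : nat) (F : {poly cvps K}) : (0 < d)%N ->
  map_poly (cvps_scale (w d)) F = F ->
  exists G, F = map_poly (cvps_ramify d) G.
Proof.
move=> d0 Finv; exists (\poly_(i < size F) cvps_unramify d F`_i).
apply/polyP => i; rewrite coef_map/= coef_poly; case: ltnP => iF; last first.
  by rewrite nth_default// rmorph0.
rewrite cvps_unramifyK// => n dn.
have := congr1 (fun G : {poly cvps K} => (G`_i : cvps K) n) Finv.
rewrite coef_map/= /ps_scale => E; apply/eqP.
have /eqP : (F`_i : cvps K) n * (w d ^+ n - 1) = 0 by rewrite mulrBr mulr1 E subrr.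
by rewrite mulf_eq0 subr_eq0 -(prim_order_dvd (w_prim d0)) (negPf dn) orbF.
Qed.

(* For the least [d] such that z1 = t^d gives a root [h], the [d] conjugates of
   [h] are distinct and their product descends to a factor of [F]. *)
Theorem irreducible_puiseux (F : {poly cvps K}) :
  F \is monic -> (1 < size F)%N -> ring_irreducible F ->
  exists h : cvps K,
    map_poly (cvps_ramify (size F).-1) F =
      \prod_(m < (size F).-1) ('X - (cvps_scale (w (size F).-1 ^+ m) h)%:P)
    /\ ((1 < (size F).-1)%N -> exists i, ~~ ((size F).-1 %| i)%N /\ h i != 0).
Proof.
move=> Fm s1 [_ Firr].
pose Q n := `[< (0 < n)%N /\ exists f, root (map_poly (cvps_ramify n) F) f >].
have /ex_minnP[d /asboolP[d0 [h hroot]] dmin] : exists n, Q n.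
  by have [n [f [n0 rf]]] := puiseux_root Fm s1; exists n; apply/asboolP; split=> //; exists f.
(* If [h] is a series in t^e, the ramification d / e already has a root, and minimality of d
   applies. *)
have descend e : (0 < e)%N -> (e %| d)%N ->
    (forall n, ~~ (e %| n)%N -> h n = 0) -> (d <= d %/ e)%N.
  move=> e0 ed hn; apply: dmin; apply/asboolP.
  have de0 : (0 < d %/ e)%N by rewrite divn_gt0// dvdn_leq.
  split=> //; exists (cvps_unramify e h); apply/eqP/(cvps_ramify_inj e0).
  rewrite -horner_map/= cvps_unramifyK// rmorph0 -map_poly_comp/=.
  rewrite (eq_map_poly (g := cvps_ramify d)) ?(eqP hroot)// => f /=.
  by rewrite cvps_ramify_comp// mulnC divnK.
have wd := w_prim d0; pose r m := cvps_scale (w d ^+ m) h.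
have rroot m : root (map_poly (cvps_ramify d) F) (r m).
  apply/eqP; rewrite -[RHS](rmorph0 (cvps_scale (w d ^+ m))) -(eqP hroot).
  rewrite -horner_map/= -map_poly_comp/=; congr (_.[_]).
  apply: eq_map_poly => f /=.
  by rewrite cvps_scale_ramify -exprM mulnC exprM (prim_expr_order wd) expr1n cvps_scale1.
have rinj : {in gtn d &, injective r}.
  move=> a b; wlog ab : a b / (a <= b)%N.
    by move=> H ad bd E; case/orP: (leq_total a b) => /H; [exact|move=> ->].
  rewrite !inE => ad bd rab; apply/eqP; rewrite eqn_leq ab /= leqNgt; apply/negP => ltab.
  (* Equality of the conjugates numbered a and b forces d to divide (b - a) n whenever h_n is
     nonzero, that is, e to divide n. Then d <= gcd(d, b - a) <= b - a < d, a contradiction. *)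
  pose e := (d %/ gcdn d (b - a))%N.
  have g0 : (0 < gcdn d (b - a))%N by rewrite gcdn_gt0 d0.
  have e0 : (0 < e)%N by rewrite divn_gt0// dvdn_leq// dvdn_gcdl.
  have dE : (e * gcdn d (b - a))%N = d by rewrite divnK ?dvdn_gcdl.
  have ed : (e %| d)%N by rewrite -[X in (_ %| X)%N]dE dvdn_mulr.
  suff : (d <= d %/ e)%N.
    have -> : (d %/ e)%N = gcdn d (b - a) by rewrite -[X in (X %/ _)%N]dE mulKn.
    rewrite leqNgt => /negP[].
    rewrite (leq_ltn_trans _ (leq_ltn_trans (leq_subr a b) bd))//.
    by rewrite dvdn_leq ?subn_gt0// dvdn_gcdr.
  apply: descend => // n; apply: contraNeq => hn.
  have : h n * w d ^+ (a * n) = h n * w d ^+ (b * n).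
    by have := congr1 (fun f : cvps K => f n) rab; rewrite /= /ps_scale !exprM.
  move/(mulfI hn)/eqP; rewrite eq_sym (eq_prim_root_expr wd) eqn_mod_dvd; last first.
    by rewrite leq_mul2r ab orbT.
  rewrite -mulnBl => dn; rewrite -(@Gauss_dvdr _ ((b - a) %/ gcdn d (b - a))).
    rewrite -(dvdn_pmul2r g0) divnK ?dvdn_gcdl// mulnAC divnK ?dvdn_gcdr//.
  rewrite /coprime -(eqn_pmul2r g0) mul1n muln_gcdl !divnK ?dvdn_gcdl ?dvdn_gcdr//.
have [||W FW] := @dvd_prod_XsubC _ (map_poly (cvps_ramify d) F) [seq r m | m <- iota 0 d]
    (@cvps_mulf_eq0 K).
- rewrite map_inj_in_uniq ?iota_uniq// => a b; rewrite !mem_iota/= !add0n.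
  exact: rinj.
- by apply/allP => _ /mapP[m _ ->]; exact: rroot.
rewrite big_map -[d in iota 0 d]subn0 -/(index_iota 0 d) big_mkord in FW.
set E := \prod_(i < d) _ in FW.
have Em : E \is monic by apply: monic_prod => i _; exact: monicXsubC.
have Einv : map_poly (cvps_scale (w d)) E = E.
  rewrite /E rmorph_prod/= -[RHS](@prod_shift_cyclic _ _ (fun m => 'X - (r m)%:P)).
    by apply: eq_bigr => i _; rewrite rmorphB/= map_polyX map_polyC/= cvps_scale_comp -exprS.
  by rewrite /r (prim_expr_order wd) expr0.
have Finv : map_poly (cvps_scale (w d)) (map_poly (cvps_ramify d) F) = map_poly (cvps_ramify d) F.
  rewrite -map_poly_comp/=; apply: eq_map_poly => f /=.
  by rewrite cvps_scale_ramify (prim_expr_order wd) cvps_scale1.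
(* [E] is monic, hence cancellable, so the cofactor inherits the invariance and descends as well. *)
have Winv : map_poly (cvps_scale (w d)) W = W.
  apply/eqP; rewrite -subr_eq0; apply/eqP/(monic_rreg Em).
  by rewrite mul0r mulrBl -FW -[in X in X - _]Einv -rmorphM/= -FW Finv subrr.
have [E' EE'] := ramified_of_invariant d0 Einv.
have [W' WW'] := ramified_of_invariant d0 Winv.
have FWE : F = W' * E'.
  apply: (@map_inj_poly _ _ (cvps_ramify d)); first exact: cvps_ramify_inj.
    exact: rmorph0.
  by rewrite rmorphM/= -WW' -EE'.
have inj1 (G : {poly cvps K}) : map_poly (cvps_ramify d) G \is monic -> G \is monic.
  move=> Gm; have sG : size (map_poly (cvps_ramify d) G) = size G.
    rewrite size_map_inj_poly//; [exact: cvps_ramify_inj|exact: rmorph0].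
  apply/monicP/(cvps_ramify_inj d0); rewrite rmorph1 -(monicP Gm) /lead_coef sG.
  by rewrite coef_map.
have E'm : E' \is monic by apply: inj1; rewrite -EE'.
have W'm : W' \is monic by move: Fm; rewrite FWE monicMr.
have sE : size E = d.+1.
  by rewrite /E size_prod_XsubC /index_enum -enumT size_enum_ord.
have W1 : W' = 1.
  have [/(ring_unit_monic W'm)//|/(ring_unit_monic E'm) E1] := Firr _ _ FWE.
  by move: sE; rewrite EE' E1 rmorph1 size_poly1 => -[d1]; rewrite -d1 in d0.
have sF : size F = d.+1.
  rewrite FWE W1 mul1r -sE EE' size_map_inj_poly//; [exact: cvps_ramify_inj|exact: rmorph0].
exists h; rewrite sF/=; split; first by rewrite FW WW' W1 rmorph1 mul1r.
move=> d1; apply: contrapT => hn.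
have /(descend d d0 (dvdnn d)) : forall n, ~~ (d %| n)%N -> h n = 0.
  by move=> n dn; apply/eqP/negP => /negP hn0; apply: hn; exists n.
by rewrite divnn d0 leqNgt d1.
Qed.
End IrreduciblePuiseux.

(** * Evaluation of convergent power series *)

Section ComplexModulus.
Variable R : realType.
Implicit Types (x y w : C R).

(** The norm takes its values in [C R] itself, where the order is partial; estimates are carried out
    with this real-valued version. *)
Definition modc x : R := complex.Re `|x|.

Lemma modcE x : `|x| = ((modc x)%:C)%C :> C R.
Proof. by rewrite /modc (RRe_real (normr_real x)). Qed.

Lemma modc_ge0 x : 0 <= modc x.
Proof. by rewrite -ler0c -modcE normr_ge0. Qed.

Lemma modc_le x (a : R) : (`|x| <= (a%:C)%C :> C R) = (modc x <= a).
Proof. by rewrite modcE lecR. Qed.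

Lemma modc_lt x (a : R) : (`|x| < (a%:C)%C :> C R) = (modc x < a).
Proof. by rewrite modcE ltcR. Qed.

Lemma modcM x y : modc (x * y) = modc x * modc y.
Proof. by apply: complexI; rewrite rmorphM/= -!modcE normrM. Qed.

Lemma modcX x n : modc (x ^+ n) = modc x ^+ n.
Proof. by apply: complexI; rewrite rmorphXn/= -!modcE normrX. Qed.

Lemma modcN x : modc (- x) = modc x.
Proof. by apply: complexI; rewrite -!modcE normrN. Qed.

Lemma modcBC x y : modc (x - y) = modc (y - x).
Proof. by rewrite -modcN opprB. Qed.

Lemma modcD x y : modc (x + y) <= modc x + modc y.
Proof. by rewrite -modc_le rmorphD/= -!modcE ler_normD. Qed.

Lemma modcB x y : modc (x - y) <= modc x + modc y.
Proof. by rewrite (le_trans (modcD _ _))// modcN. Qed.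

Lemma modc0 : modc 0 = 0.
Proof. by rewrite /modc normr0. Qed.

Lemma modc1 : modc 1 = 1.
Proof. by rewrite /modc normr1. Qed.

Lemma modc_eq0 x : (modc x == 0) = (x == 0).
Proof. by rewrite -(inj_eq (@complexI R)) -modcE normr_eq0. Qed.

Lemma modc_gt0 x : (0 < modc x) = (x != 0).
Proof. by rewrite lt_neqAle modc_ge0 andbT eq_sym modc_eq0. Qed.

Lemma modc_sum n (F : nat -> C R) :
  modc (\sum_(i < n) F i) <= \sum_(i < n) modc (F i).
Proof.
elim: n => [|n IHn]; first by rewrite !big_ord0 modc0.
by rewrite !big_ord_recr/= (le_trans (modcD _ _))// lerD2r.
Qed.

Lemma modc_real (a : R) : modc ((a%:C)%C : C R) = `|a|.
Proof. by rewrite /modc normc_def/= expr0n addr0 sqrtr_sqr. Qed.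

Lemma modcn n : modc (n%:R : C R) = n%:R.
Proof. by apply: complexI; rewrite -modcE normr_nat rmorph_nat. Qed.

Lemma Re_le_modc x : `|complex.Re x| <= modc x.
Proof. by rewrite -lecR -modcE; exact: normc_ge_Re. Qed.

Lemma Im_le_modc x : `|complex.Im x| <= modc x.
Proof.
have -> : modc x = modc (x * 'i%C) by rewrite modcM {3}/modc normc_def/= expr0n add0r expr1n sqrtr1 mulr1.
by rewrite -normrN -ReiNIm Re_le_modc.
Qed.

Lemma modc_le_ReIm x : modc x <= `|complex.Re x| + `|complex.Im x|.
Proof.
rewrite {1}[x]complexE (le_trans (modcD _ _))// modcM !modc_real.
by rewrite {1}/modc normc_def/= expr0n add0r expr1n sqrtr1 mul1r.
Qed.

Lemma near_modc x (P : C R -> Prop) :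
  (\forall w \near x, P w) <-> exists2 e : R, 0 < e & forall w, modc (w - x) < e -> P w.
Proof.
split=> [/nbhs_normP[e/= e0 eP]|[e e0 eP]].
  have eR : e = ((complex.Re e)%:C)%C by rewrite RRe_real// gtr0_real.
  exists (complex.Re e); first by rewrite -ltcR -eR.
  move=> w wx; apply: eP => /=; rewrite /ball_/= distrC eR.
  by rewrite -modc_lt in wx.
apply/nbhs_normP; exists (e%:C)%C; first by rewrite /= ltcR.
by move=> w /=; rewrite /ball_/= distrC => wx; apply: eP; rewrite -modc_lt.
Qed.

Lemma cvg_modc (u : nat -> C R) l : u @ \oo --> l <->
  forall e : R, 0 < e -> exists N, forall n, (N <= n)%N -> modc (u n - l) < e.
Proof.
split=> [/cvgrPdist_lt ul e e0|ul].
  have e0' : 0 < (e%:C)%C :> C R by rewrite ltcR.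
  have [N _ NP] := ul _ e0'; exists N => n Nn.
  by have := NP n Nn; rewrite /= modc_lt modcBC.
apply/cvgrPdist_lt => e e0.
have eR : e = ((complex.Re e)%:C)%C by rewrite RRe_real// gtr0_real.
have [|N NP] := ul (complex.Re e); first by rewrite -ltcR -eR.
by exists N => // n Nn; rewrite /= eR modc_lt modcBC; exact: NP.
Qed.

Lemma cvg_complex (u : nat -> C R) (a b : R) :
  (fun n => complex.Re (u n)) @ \oo --> a -> (fun n => complex.Im (u n)) @ \oo --> b ->
  u @ \oo --> ((a +i* b)%C : C R).
Proof.
move=> /cvgrPdist_lt ua /cvgrPdist_lt ub; apply/cvg_modc => e e0.
have e2 : 0 < e / 2 by rewrite divr_gt0.
have [N _ NP] := ua _ e2; have [M _ MP] := ub _ e2.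
exists (maxn N M) => n; rewrite geq_max => /andP[Nn Mn].
apply: le_lt_trans (modc_le_ReIm _) _; rewrite [ltRHS]splitr.
have -> : complex.Re (u n - (a +i* b)%C) = complex.Re (u n) - a by case: (u n).
have -> : complex.Im (u n - (a +i* b)%C) = complex.Im (u n) - b by case: (u n).
by rewrite ltrD// distrC; [exact: NP|exact: MP].
Qed.

Lemma modc_cvg_le (u : nat -> C R) l (B : R) :
  u @ \oo --> l -> (forall n, modc (u n) <= B) -> modc l <= B.
Proof.
move=> /cvg_modc ul uB; apply/ler_addgt0Pr => e e0.
have [N NP] := ul e e0; have h := NP N (leqnn N).
have -> : l = u N - (u N - l) by rewrite opprB addrC subrK.
apply: le_trans (modcB _ _) _.
by rewrite lerD ?uB// ltW.
Qed.

(** Real and imaginary parts converge absolutely by comparison with a geometric series, and are then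
    reassembled. *)
Lemma cvg_geometric_bound (z : nat -> C R) (B x : R) : 0 <= x <= 2^-1 ->
  (forall n, modc (z n) <= B * x ^+ n) ->
  exists l : C R, [series z n]_n @ \oo --> l.
Proof.
move=> /andP[x0 x2] zB.
have x1 : `|x| < 1 by rewrite ger0_norm//; lra.
have B0 : 0 <= B by have := zB 0%N; rewrite expr0 mulr1; exact: le_trans (modc_ge0 _).
have part (f : C R -> R) : (forall w, `|f w| <= modc w) ->
    (forall a b, f (a + b) = f a + f b) -> f 0 = 0 ->
    exists a : R, (fun n => f ([series z n]_n n)) @ \oo --> a.
  move=> fle fD f0.
  have cv : cvgn (series (fun n => f (z n))).
    apply: normed_cvg; apply: (@series_le_cvg _ _ (geometric B x)).
    - by move=> n; exact: normr_ge0.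
    - by move=> n; rewrite /= mulr_ge0// exprn_ge0.
    - by move=> n; apply: le_trans (fle _) (zB n).
    - exact: is_cvg_geometric_series.
  exists (limn (series (fun n => f (z n)))).
  rewrite (_ : (fun n => _) = series (fun n => f (z n)))//.
  apply/funext => n; rewrite /series/=.
  by elim/big_rec2 : _ => // i a b _ <-; rewrite fD.
have [a ca] := part (@complex.Re R) Re_le_modc (fun a b => raddfD _ a b) erefl.
have [b cb] := part (@complex.Im R) Im_le_modc (fun a b => raddfD _ a b) erefl.
by exists (a +i* b)%C; apply: cvg_complex.
Qed.

End ComplexModulus.

Section Evaluation.
Variable R : realType.
Implicit Types (f g : cvps (C R)) (w : C R).

(** Explicit constants yield an explicit disc: where [rho * modc w <= 2^-1], the n-th term is at
    most B / 2^n. *)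
Definition cvps_bounded (B rho : R) f :=
  [/\ 0 <= B, 1 <= rho & forall n, modc (f n) <= B * rho ^+ n].

Lemma cvps_boundedP f : exists B rho, cvps_bounded B rho f.
Proof.
have /ps_convergentP[B [rho [B0 rho1 fB]]] := cvps_conv f.
have BR : B = ((complex.Re B)%:C)%C by rewrite RRe_real// ger0_real.
have rR : rho = ((complex.Re rho)%:C)%C.
  by rewrite RRe_real// ger0_real// (le_trans _ rho1).
exists (complex.Re B), (complex.Re rho); split.
- by rewrite -lecR -BR.
- by rewrite -lecR -rR.
- by move=> n; rewrite -modc_le rmorphM rmorphXn/= -BR -rR.
Qed.

Lemma cvps_bounded_weaken B rho rho' f : rho <= rho' ->
  cvps_bounded B rho f -> cvps_bounded B rho' f.
Proof.
move=> le [B0 r1 fB]; split=> //; first exact: le_trans r1 le.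
move=> n; apply: le_trans (fB n) _; rewrite ler_wpM2l// lerXn2r// nnegrE; lra.
Qed.

Lemma geometric_sum_le2 (x : R) n : 0 <= x <= 2^-1 -> \sum_(i < n) x ^+ i <= 2.
Proof.
move=> /andP[x0 x2]; suff : \sum_(i < n) x ^+ i + 2 * x ^+ n <= 2.
  by apply: le_trans; rewrite lerDl mulr_ge0// exprn_ge0.
elim: n => [|n IHn]; first by rewrite big_ord0 expr0 add0r mulr1.
apply: le_trans IHn; rewrite big_ord_recr/= -addrA lerD2l exprS.
have := exprn_ge0 n x0; move: (x ^+ n) => y y0; nra.
Qed.

Lemma geometric_small (B e : R) : 0 < e ->
  exists N, forall n, (N <= n)%N -> B * 2^-1 ^+ n < e.
Proof.
move=> e0; have := @cvg_geometric R B 2^-1.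
rewrite ger0_norm ?invr_ge0// invf_lt1 ?ltr1n// => /(_ isT)/cvgrPdist_lt/(_ e e0)[N _ NP].
exists N => n Nn; apply: le_lt_trans (NP n Nn).
by rewrite sub0r normrN ler_norm.
Qed.

Definition psum f w n := \sum_(i < n) f i * w ^+ i.

Lemma seriesE f w : [series f n * w ^+ n]_n = psum f w.
Proof. by apply/funext => n; rewrite /series/= big_mkord. Qed.

Lemma cvps_term_le B rho f w n : cvps_bounded B rho f ->
  modc (f n * w ^+ n) <= B * (rho * modc w) ^+ n.
Proof.
move=> [B0 r1 fB]; rewrite modcM modcX exprMn mulrA.
by rewrite ler_wpM2r// exprn_ge0// modc_ge0.
Qed.

Lemma psum_le B rho f w n : cvps_bounded B rho f -> rho * modc w <= 2^-1 ->
  modc (psum f w n) <= B * 2.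
Proof.
move=> fB w2; have [B0 r1 _] := fB.
apply: le_trans (modc_sum _ (fun i => f i * w ^+ i)) _.
apply: (@le_trans _ _ (\sum_(i < n) B * (rho * modc w) ^+ i)).
  by apply: ler_sum => i _; exact: cvps_term_le.
rewrite -mulr_sumr ler_wpM2l// geometric_sum_le2// w2 andbT mulr_ge0 ?modc_ge0//; lra.
Qed.

Lemma cvps_cvg B rho f w : cvps_bounded B rho f -> rho * modc w <= 2^-1 ->
  psum f w @ \oo --> cvps_eval f w.
Proof.
move=> fB w2; have [B0 r1 _] := fB.
have [||l lP] := @cvg_geometric_bound R (fun n => f n * w ^+ n) B (rho * modc w).
- by rewrite w2 andbT mulr_ge0 ?modc_ge0//; lra.
- by move=> n; exact: cvps_term_le.
rewrite /cvps_eval; have := lP; rewrite seriesE => h.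
by rewrite (cvg_lim (@norm_hausdorff _ _) h).
Qed.

Lemma cvps_eval_le B rho f w : cvps_bounded B rho f -> rho * modc w <= 2^-1 ->
  modc (cvps_eval f w) <= B * 2.
Proof.
by move=> fB w2; apply: modc_cvg_le (cvps_cvg fB w2) _ => n; exact: (psum_le _ fB).
Qed.

Lemma psum_cvg_unique f w (l l' : C R) : psum f w @ \oo --> l -> psum f w @ \oo --> l' -> l = l'.
Proof. by move=> h h'; exact: (cvg_unique (@norm_hausdorff _ _) h h'). Qed.

Lemma near0_scaled (c e : R) (P : C R -> Prop) : 0 <= c -> 0 < e ->
  (forall w, c * modc w <= e -> P w) -> \forall w \near (0 : C R), P w.
Proof.
move=> c0 e0 H; apply/near_modc; exists (e / (c + 1)).
  by rewrite divr_gt0//; lra.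
move=> w; rewrite subr0 ltr_pdivlMr; last by lra.
move=> wlt; apply: H; have := modc_ge0 w; nra.
Qed.

Lemma cvps_cvg_near f : \forall w \near (0 : C R), psum f w @ \oo --> cvps_eval f w.
Proof.
have [B [rho fB]] := cvps_boundedP f; have [B0 r1 _] := fB.
apply: (@near0_scaled rho 2^-1) => [||w]; rewrite ?invr_gt0//; first lra.
exact: cvps_cvg fB.
Qed.

Lemma cvps_evalD f g : \forall w \near (0 : C R),
  cvps_eval (f + g) w = cvps_eval f w + cvps_eval g w.
Proof.
apply: filterS3 (cvps_cvg_near f) (cvps_cvg_near g) (cvps_cvg_near (f + g)).
move=> w cf cg cfg.
apply: (psum_cvg_unique cfg).
have -> : psum (f + g) w = psum f w \+ psum g w.
  apply/funext => n; rewrite /psum /= -big_split/=; apply: eq_bigr => i _.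
  exact: mulrDl.
exact: cvgD cf cg.
Qed.

(** The product of the partial sums exceeds the partial sum of the product by the terms with i, j <
    n <= i + j. For each i they amount to at most 2 A B x^n with x = rho |w|. There are n values of
    i, and requiring x <= 1/4 absorbs this factor through n <= 2^n. *)
Lemma cvps_evalM f g : \forall w \near (0 : C R),
  cvps_eval (f * g) w = cvps_eval f w * cvps_eval g w.
Proof.
have [A [r1 fA]] := cvps_boundedP f; have [B [r2 gB]] := cvps_boundedP g.
pose rho := Num.max r1 r2.
have {}fA : cvps_bounded A rho f by apply: cvps_bounded_weaken fA; rewrite le_max lexx.
have {}gB : cvps_bounded B rho g.
  by apply: cvps_bounded_weaken gB; rewrite le_max lexx orbT.
have [A0 rho1 _] := fA; have [B0 _ _] := gB.
have cfg := cvps_cvg_near (f * g).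
suff H : \forall w \near (0 : C R), psum (f * g) w @ \oo --> cvps_eval f w * cvps_eval g w.
  by apply: filterS2 cfg H => w; exact: psum_cvg_unique.
apply: (@near0_scaled rho 4^-1) => [||w w4]; rewrite ?invr_gt0//; first lra.
have w2 : rho * modc w <= 2^-1 by lra.
have fgc : (psum f w \* psum g w) @ \oo --> cvps_eval f w * cvps_eval g w.
  by apply: cvgM; [exact: cvps_cvg fA w2|exact: cvps_cvg gB w2].
set x := rho * modc w in w4 w2.
have x0 : 0 <= x by rewrite mulr_ge0 ?modc_ge0//; lra.
have key n : modc (psum f w n * psum g w n - psum (f * g) w n) <= 2 * A * B * 2^-1 ^+ n.
  pose a i := f i * w ^+ i; pose b i := g i * w ^+ i.
  have -> : psum (f * g) w n = \sum_(i < n) a i * \sum_(j < n - i) b j.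
    rewrite -sum_ps_mul; apply: eq_bigr => i _.
    by rewrite /a /b -ps_mul_weight.
  rewrite {1 2}/psum mulr_suml -sumrB.
  apply: le_trans (modc_sum _ (fun i => a i * (\sum_(j < n) b j) - a i * \sum_(j < n - i) b j)) _.
  apply: (@le_trans _ _ (\sum_(i < n) 2 * A * B * x ^+ n)).
    apply: ler_sum => i _; rewrite -mulrBr.
    rewrite -[X in \sum_(j < X) b j - _](subnK (ltnW (ltn_ord i))) big_split_ord/=.
    rewrite addrAC subrr add0r modcM.
    have hb : modc (\sum_(j < i) b (n - i + j)%N) <= B * x ^+ (n - i) * 2.
      apply: le_trans (modc_sum _ (fun j => b (n - i + j)%N)) _.
      apply: (@le_trans _ _ (\sum_(j < i) B * x ^+ (n - i) * x ^+ j)).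
        by apply: ler_sum => j _; rewrite -mulrA -exprD; exact: cvps_term_le.
      rewrite -mulr_sumr ler_wpM2l ?mulr_ge0 ?exprn_ge0// geometric_sum_le2//.
      by rewrite x0.
    have ha : modc (a i) <= A * x ^+ i by exact: cvps_term_le.
    apply: le_trans (ler_pM (modc_ge0 _) (modc_ge0 _) ha hb) _.
    rewrite -[in leRHS](subnKC (ltnW (ltn_ord i))) exprD.
    rewrite le_eqVlt; apply/orP; left; apply/eqP; ring.
  rewrite sumr_const card_ord -mulrnAr ler_wpM2l ?mulr_ge0//.
  have x4 : x ^+ n <= 4^-1 ^+ n by rewrite lerXn2r// nnegrE.
  have n2 : (n%:R : R) <= 2 ^+ n by rewrite -natrX ler_nat ltnW// ltn_expl.
  rewrite -mulr_natl.
  apply: (@le_trans _ _ (2 ^+ n * 4^-1 ^+ n)); first by rewrite ler_pM// exprn_ge0.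
  by rewrite -exprMn (_ : 2 * 4^-1 = 2^-1 :> R)//; field.
apply/cvg_modc => e e0; have e2 : 0 < e / 2 by rewrite divr_gt0.
have /cvg_modc/(_ _ e2)[N NP] := fgc.
have [M MP] := geometric_small (2 * A * B) e2.
exists (maxn N M) => n; rewrite geq_max => /andP[Nn Mn].
have := NP n Nn; have := MP n Mn; have := key n; rewrite /= => h1 h2 h3.
have -> : psum (f * g) w n - cvps_eval f w * cvps_eval g w =
  (psum f w n * psum g w n - cvps_eval f w * cvps_eval g w) -
  (psum f w n * psum g w n - psum (f * g) w n) by ring.
by apply: le_lt_trans (modcB _ _) _; lra.
Qed.

End Evaluation.

Section EvaluationMorphism.
Variable R : realType.
Implicit Types (f g : cvps (C R)) (w : C R) (F G : {poly cvps (C R)}).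

Lemma cvps_eval_of_cvg f w (l : C R) : psum f w @ \oo --> l -> cvps_eval f w = l.
Proof. by move=> h; rewrite /cvps_eval seriesE; exact: (cvg_lim (@norm_hausdorff _ _) h). Qed.

Lemma cvg_eventually_const (u : nat -> C R) (N : nat) (l : C R) :
  (forall n, (N <= n)%N -> u n = l) -> u @ \oo --> l.
Proof.
move=> uN; apply/cvg_modc => e e0; exists N => n /uN ->.
by rewrite subrr modc0.
Qed.

Lemma cvps_eval_poly (q : {poly C R}) w : cvps_eval (cvps_poly q) w = q.[w].
Proof.
apply/cvps_eval_of_cvg/(@cvg_eventually_const _ (size q)) => n qn.
by rewrite (horner_coef_wide _ qn).
Qed.

Lemma cvps_eval0 w : cvps_eval (0 : cvps (C R)) w = 0.
Proof. by rewrite -(rmorph0 (@cvps_poly (C R))) cvps_eval_poly horner0. Qed.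

Lemma cvps_eval1 w : cvps_eval (1 : cvps (C R)) w = 1.
Proof. by rewrite -(rmorph1 (@cvps_poly (C R))) cvps_eval_poly hornerC. Qed.

Lemma cvps_eval_at0 f : cvps_eval f 0 = f 0%N.
Proof.
apply/cvps_eval_of_cvg/(@cvg_eventually_const _ 1) => -[//|n] _.
rewrite /psum big_ord_recl/= expr0 mulr1 big1 ?addr0// => i _.
by rewrite expr0n mulr0.
Qed.

Lemma cvps_eval_scale (c : C R) f w : cvps_eval (cvps_scale c f) w = cvps_eval f (c * w).
Proof.
rewrite /cvps_eval !seriesE; congr (limn _); apply/funext => n.
by apply: eq_bigr => i _; rewrite /= /ps_scale exprMn mulrA.
Qed.

Lemma near0_expr (P : C R -> Prop) d : (0 < d)%N ->
  (\forall w \near (0 : C R), P w) -> \forall w \near (0 : C R), P (w ^+ d).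
Proof.
move=> d0 /near_modc[e e0 eP]; apply/near_modc; exists (Num.min e 1).
  by rewrite lt_min e0 ltr01.
move=> w; rewrite subr0 lt_min => /andP[we w1]; apply: eP; rewrite subr0 modcX.
case: d d0 => // d _; rewrite exprS.
have := exprn_ile1 d (modc_ge0 w) (ltW w1).
have := exprn_ge0 d (modc_ge0 w); have := modc_ge0 w; nra.
Qed.

Lemma near0_mulr (P : C R -> Prop) (c : C R) :
  (\forall w \near (0 : C R), P w) -> \forall w \near (0 : C R), P (c * w).
Proof.
move=> /near_modc[e e0 eP]; apply: (@near0_scaled _ (modc c) (e / 2)); first exact: modc_ge0.
  by rewrite divr_gt0.
by move=> w cw; apply: eP; rewrite subr0 modcM; lra.
Qed.

Lemma psum_ramify d f w n : (0 < d)%N ->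
  psum (cvps_ramify d f) w (n * d) = psum f (w ^+ d) n.
Proof.
move=> d0; elim: n => [|n IHn]; first by rewrite mul0n /psum !big_ord0.
rewrite mulSn addnC {1}/psum big_split_ord/= -/(psum (cvps_ramify d f) w (n * d)) IHn.
rewrite [RHS]big_ord_recr/=; congr (_ + _).
case: d d0 {IHn} => // d _; rewrite big_ord_recl/= addn0 big1 ?addr0 => [|i _].
  by rewrite /ps_ramify dvdn_mull// mulnK// mulnC exprM.
rewrite /ps_ramify dvdn_addr ?dvdn_mull// gtnNdvd ?mul0r//.
by rewrite /bump/= add1n ltnS.
Qed.

(** Both series converge near 0, so the limit may be taken along multiples of d, where the partial
    sums agree. *)
Lemma cvps_eval_ramify d f : (0 < d)%N ->
  \forall w \near (0 : C R), cvps_eval (cvps_ramify d f) w = cvps_eval f (w ^+ d).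
Proof.
move=> d0; apply: filterS2 (cvps_cvg_near (cvps_ramify d f)) (near0_expr d0 (cvps_cvg_near f)).
move=> w /cvg_modc h1 h2; apply: (psum_cvg_unique _ h2).
apply/cvg_modc => e e0; have [N NP] := h1 e e0; exists N => n Nn.
by rewrite -psum_ramify//; apply: NP; rewrite (leq_trans Nn)// leq_pmulr.
Qed.

Lemma near0_forall (I : finType) (P : I -> C R -> Prop) :
  (forall i, \forall w \near (0 : C R), P i w) ->
  \forall w \near (0 : C R), forall i, P i w.
Proof. by move=> H; exact: (@filter_forall _ _ P (nbhs (0 : C R)) _ H). Qed.

Lemma near0W (P : C R -> Prop) : (forall w, P w) -> \forall w \near (0 : C R), P w.
Proof. by move=> H; apply/near_modc; exists 1. Qed.

Lemma cvps_evalN f : \forall w \near (0 : C R), cvps_eval (- f) w = - cvps_eval f w.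
Proof.
apply: filterS (cvps_evalD f (- f)) => w; rewrite subrr cvps_eval0 => /esym/eqP.
by rewrite addrC addr_eq0 => /eqP.
Qed.

Lemma cvps_eval_sum n (h : nat -> cvps (C R)) : \forall w \near (0 : C R),
  cvps_eval (\sum_(i < n) h i) w = \sum_(i < n) cvps_eval (h i) w.
Proof.
elim: n => [|n IHn]; first by apply: near0W => w; rewrite !big_ord0 cvps_eval0.
apply: filterS2 IHn (cvps_evalD (\sum_(i < n) h i) (h n)) => w IH.
by rewrite !big_ord_recr/= => ->; rewrite IH.
Qed.

Lemma cvps_evalX f n : \forall w \near (0 : C R), cvps_eval (f ^+ n) w = cvps_eval f w ^+ n.
Proof.
elim: n => [|n IHn]; first by apply: near0W => w; rewrite !expr0 cvps_eval1.
by apply: filterS2 IHn (cvps_evalM f (f ^+ n)) => w IH; rewrite !exprS => ->; rewrite IH.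
Qed.

Lemma cvps_eval_horner F g : \forall w \near (0 : C R),
  cvps_eval F.[g] w = weierstrass_eval F (w, cvps_eval g w).
Proof.
rewrite horner_coef.
have H : \forall w \near (0 : C R), forall i : 'I_(size F),
    cvps_eval (F`_i * g ^+ i) w = cvps_eval F`_i w * cvps_eval g w ^+ i.
  apply: near0_forall => i.
  apply: filterS2 (cvps_evalM F`_i (g ^+ i)) (cvps_evalX g i) => w -> ->.
  by [].
apply: filterS2 H (cvps_eval_sum (size F) (fun i => F`_i * g ^+ i)) => w H ->.
by apply: eq_bigr => i _; exact: H.
Qed.

(** Specialization of z1. For a fixed w it need not be multiplicative, since the disc on which
    evaluation respects a product depends on the factors. *)
Definition poly_eval F w : {poly C R} := \poly_(i < size F) cvps_eval F`_i w.

Lemma coef_poly_eval F w i : (poly_eval F w)`_i = cvps_eval F`_i w.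
Proof. by rewrite coef_poly; case: ltnP => // Fi; rewrite nth_default// cvps_eval0. Qed.

Lemma weierstrass_evalE F (z : C R * C R) : weierstrass_eval F z = (poly_eval F z.1).[z.2].
Proof. by rewrite horner_poly. Qed.

Lemma poly_evalM F G : \forall w \near (0 : C R),
  poly_eval (F * G) w = poly_eval F w * poly_eval G w.
Proof.
have H : \forall w \near (0 : C R), forall i : 'I_(size F + size G),
    cvps_eval (F * G)`_i w = \sum_(j < i.+1) cvps_eval F`_j w * cvps_eval G`_(i - j) w.
  apply: near0_forall => i; rewrite coefM.
  have H : \forall w \near (0 : C R), forall j : 'I_i.+1,
      cvps_eval (F`_j * G`_(i - j)) w = cvps_eval F`_j w * cvps_eval G`_(i - j) w.
    by apply: near0_forall => j; exact: cvps_evalM.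
  apply: filterS2 H (cvps_eval_sum i.+1 (fun j => F`_j * G`_(i - j))) => w H ->.
  by apply: eq_bigr => j _; exact: H.
apply: filterS H => w H; apply/polyP => i; rewrite coef_poly_eval [RHS]coefM.
under [RHS]eq_bigr do rewrite !coef_poly_eval.
have [iFG|iFG] := ltnP i (size F + size G); first exact: (H (Ordinal iFG)).
rewrite nth_default; last first.
  by rewrite (leq_trans (size_polyMleq _ _))// (leq_trans _ iFG)// leq_pred.
rewrite cvps_eval0 big1// => j _.
have [jF|Fj] := ltnP j (size F); last by rewrite [F`_j]nth_default// cvps_eval0 mul0r.
rewrite [G`__]nth_default ?cvps_eval0 ?mulr0//.
by rewrite leq_subRL ?leq_ord//; apply: leq_trans iFG; rewrite leq_add2r ltnW.
Qed.

Lemma poly_eval1 w : poly_eval 1 w = 1.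
Proof.
apply/polyP => i; rewrite coef_poly_eval !coef1.
by case: (i == 0)%N; rewrite ?cvps_eval1 ?cvps_eval0.
Qed.

Lemma poly_eval_prod n (H : nat -> {poly cvps (C R)}) : \forall w \near (0 : C R),
  poly_eval (\prod_(i < n) H i) w = \prod_(i < n) poly_eval (H i) w.
Proof.
elim: n => [|n IHn]; first by apply: near0W => w; rewrite !big_ord0 poly_eval1.
apply: filterS2 IHn (poly_evalM (\prod_(i < n) H i) (H n)) => w IH.
by rewrite !big_ord_recr/= => ->; rewrite IH.
Qed.

Lemma poly_eval_XsubC f : \forall w \near (0 : C R),
  poly_eval ('X - f%:P) w = 'X - (cvps_eval f w)%:P.
Proof.
apply: filterS (cvps_evalN f) => w fN; apply/polyP => i.
rewrite coef_poly_eval !coefB !coefX !coefC.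
case: i => [|[|i]] /=; [by rewrite !sub0r|by rewrite !subr0 cvps_eval1|].
by rewrite !subr0 cvps_eval0.
Qed.

Lemma poly_eval_ramify d F : (0 < d)%N -> \forall w \near (0 : C R),
  poly_eval (map_poly (cvps_ramify d) F) w = poly_eval F (w ^+ d).
Proof.
move=> d0.
have H : \forall w \near (0 : C R), forall i : 'I_(size F),
    cvps_eval (cvps_ramify d F`_i) w = cvps_eval F`_i (w ^+ d).
  by apply: near0_forall => i; exact: cvps_eval_ramify.
apply: filterS H => w H; apply/polyP => i; rewrite [LHS]coef_poly_eval [RHS]coef_poly_eval coef_map/=.
have [iF|Fi] := ltnP i (size F); first exact: (H (Ordinal iF)).
by rewrite nth_default// rmorph0 !cvps_eval0.
Qed.

Lemma weierstrass_eval_factor F (d : nat) (c : nat -> C R) f : (0 < d)%N ->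
  map_poly (cvps_ramify d) F = \prod_(m < d) ('X - (cvps_scale (c m) f)%:P) ->
  \forall t \near (0 : C R), forall y : C R,
    weierstrass_eval F (t ^+ d, y) = \prod_(m < d) (y - cvps_eval f (c m * t)).
Proof.
move=> d0 Ff.
have H : \forall w \near (0 : C R), forall m : 'I_d,
    poly_eval ('X - (cvps_scale (c m) f)%:P) w = 'X - (cvps_eval (cvps_scale (c m) f) w)%:P.
  by apply: near0_forall => i; exact: poly_eval_XsubC.
apply: filterS3 H (poly_eval_ramify F d0)
  (poly_eval_prod d (fun m => 'X - (cvps_scale (c m) f)%:P)) => t H1 H2 H3 y.
rewrite weierstrass_evalE/= -H2 Ff H3 horner_prod; apply: eq_bigr => m _.
by rewrite H1 hornerXsubC cvps_eval_scale.
Qed.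

End EvaluationMorphism.

(** * Taylor estimates, isolated zeros, holomorphy and conjugation *)

Section Derivative.
Variable R : realType.
Implicit Types (f g : cvps (C R)) (w h : C R).

Lemma deriv_coef_le B rho f n : cvps_bounded B rho f ->
  modc (f n.+1 * n.+1%:R) <= B * rho * (2 * rho) ^+ n.
Proof.
move=> [B0 r1 fB]; rewrite modcM modcn.
have n2 : (n.+1%:R : R) <= 2 ^+ n by rewrite -natrX ler_nat ltn_expl.
apply: le_trans (ler_pM (modc_ge0 _) _ (fB n.+1) n2) _ => //.
by rewrite exprMn exprS le_eqVlt; apply/orP; left; apply/eqP; ring.
Qed.

Lemma ps_convergent_deriv f : ps_convergent (fun n => f n.+1 * n.+1%:R).
Proof.
have [B [rho fB]] := cvps_boundedP f; have [B0 r1 _] := fB.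
apply/ps_convergentP; exists ((B * rho)%:C)%C, ((2 * rho)%:C)%C; split.
- by rewrite ler0c mulr_ge0//; lra.
- by rewrite -[1]/((1%:C)%C : C R) lecR; lra.
- by move=> n; rewrite -rmorphXn -rmorphM modc_le; exact: deriv_coef_le.
Qed.

Definition cvps_deriv f := mk_cvps (ps_convergent_deriv f).

(** The remainder for n + 1 is (w + h) times the one for n, plus n w^(n-1) h^2. Multiplying by s^2
    avoids the exponent n - 2, and 2^n is a crude substitute for the binomial factor. *)
Lemma expr_taylor_le (s : R) w h n : modc w <= s -> modc (w + h) <= s ->
  modc ((w + h) ^+ n - w ^+ n - n%:R * w ^+ n.-1 * h) * s ^+ 2 <= modc h ^+ 2 * (2 * s) ^+ n.
Proof.
move=> ws whs; have s0 : 0 <= s by apply: le_trans ws; exact: modc_ge0.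
elim: n => [|n IHn].
  by rewrite !expr0 subrr !mul0r subrr modc0 mul0r mulr1 exprn_ge0 ?modc_ge0.
set D := (X in modc X * _ <= _) in IHn.
have -> : (w + h) ^+ n.+1 - w ^+ n.+1 - n.+1%:R * w ^+ n.+1.-1 * h =
    (w + h) * D + n%:R * w ^+ n.-1 * h ^+ 2.
  rewrite /D -natr1 /=; case: n {IHn D} => [|n]; first by rewrite !expr0 expr1; ring.
  by rewrite /= !exprS; ring.
have h2 : 0 <= modc h ^+ 2 by rewrite exprn_ge0 ?modc_ge0.
have n2 : (n%:R : R) <= 2 ^+ n by rewrite -natrX ler_nat ltnW// ltn_expl.
have key : modc (n%:R * w ^+ n.-1 * h ^+ 2) * s ^+ 2 <= modc h ^+ 2 * (s * (2 * s) ^+ n).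
  rewrite !modcM modcn !modcX.
  rewrite (_ : _ * s ^+ 2 = modc h ^+ 2 * (n%:R * modc w ^+ n.-1 * s ^+ 2)); last by ring.
  apply: ler_wpM2l => //.
  case: n n2 {IHn D} => [|n] n2; first by rewrite mul0r mul0r mulr_ge0// exprn_ge0// mulr_ge0.
  rewrite /= exprMn (exprS s n) expr2.
  have : modc w ^+ n <= s ^+ n by rewrite lerXn2r// nnegrE modc_ge0.
  have := exprn_ge0 n (modc_ge0 w); have := exprn_ge0 n s0.
  move: (modc w ^+ n) (s ^+ n) => a b b0 a0 ab.
  have n0 : 0 <= n.+1%:R :> R by [].
  rewrite (_ : s * (2 ^+ n.+1 * (s * b)) = 2 ^+ n.+1 * b * (s * s)); last by ring.
  by rewrite ler_wpM2r ?mulr_ge0// ler_pM.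
rewrite (exprS (2 * s)).
apply: (@le_trans _ _ (s * (modc D * s ^+ 2) + modc (n%:R * w ^+ n.-1 * h ^+ 2) * s ^+ 2)).
  rewrite mulrA -mulrDl ler_wpM2r ?exprn_ge0// (le_trans (modcD _ _))// lerD2r modcM.
  by rewrite ler_wpM2r ?modc_ge0.
rewrite (_ : _ * (2 * s * _) = s * (modc h ^+ 2 * (2 * s) ^+ n) + modc h ^+ 2 * (s * (2 * s) ^+ n)).
  by rewrite lerD// ler_wpM2l.
by ring.
Qed.

Lemma cvg_shift1 (u : nat -> C R) (l : C R) : u @ \oo --> l -> (fun n => u n.+1) @ \oo --> l.
Proof.
move=> /cvg_modc ul; apply/cvg_modc => e /ul[N NP].
by exists N => n Nn; apply: NP; rewrite (leq_trans Nn).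
Qed.

Lemma cvps_taylor f : exists2 s : R, 0 < s & exists2 A : R, 0 <= A &
  (forall w h, modc w <= s -> modc (w + h) <= s ->
     modc (cvps_eval f (w + h) - cvps_eval f w - h * cvps_eval (cvps_deriv f) w)
       <= A * modc h ^+ 2) /\
  (forall w, modc w <= s -> modc (cvps_eval (cvps_deriv f) w) <= A).
Proof.
have [B [rho fB]] := cvps_boundedP f; have [B0 r1 _] := fB.
(* With this radius 2 rho s = 1/2: this serves both the derivative, whose growth rate is 2 rho, and
   the factor (2 s)^n of the Taylor remainder. *)
pose s := (4 * rho)^-1; have s0 : 0 < s by rewrite invr_gt0; lra.
have rs : rho * s = 4^-1 by rewrite /s; field; lra.
have f'B : cvps_bounded (B * rho) (2 * rho) (cvps_deriv f).
  by split; [rewrite mulr_ge0//; lra|lra|move=> n; exact: deriv_coef_le].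
have f2 w : modc w <= s -> rho * modc w <= 2^-1.
  by move=> ws; have : rho * modc w <= rho * s; [rewrite ler_wpM2l//; lra|lra].
have f'2 w : modc w <= s -> 2 * rho * modc w <= 2^-1.
  move=> ws; have : rho * modc w <= rho * s; first by rewrite ler_wpM2l//; lra.
  by rewrite rs -mulrA; lra.
pose A1 := 2 * B / s ^+ 2; pose A2 := B * rho * 2.
have A10 : 0 <= A1 by rewrite divr_ge0 ?sqr_ge0// mulr_ge0.
have A20 : 0 <= A2 by rewrite !mulr_ge0//; lra.
exists s => //; exists (A1 + A2); first lra.
split=> [w h ws whs|w ws]; last first.
  by apply: le_trans (cvps_eval_le f'B (f'2 w ws)) _; rewrite -/A2; lra.
apply: (@le_trans _ _ (A1 * modc h ^+ 2)); last first.
  by rewrite ler_wpM2r ?exprn_ge0 ?modc_ge0//; lra.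
(* The partial sums of [f] have one term more than that of the derivative, so that all involve the
   same coefficients. *)
pose u n := psum f (w + h) n.+1 - psum f w n.+1 - h * psum (cvps_deriv f) w n.
have cu : u @ \oo --> cvps_eval f (w + h) - cvps_eval f w - h * cvps_eval (cvps_deriv f) w.
  apply: cvgB; last by apply: cvgMr; exact: cvps_cvg f'B (f'2 w ws).
  by apply: cvgB; apply: cvg_shift1; [exact: cvps_cvg fB (f2 _ whs)|exact: cvps_cvg fB (f2 _ ws)].
apply: (modc_cvg_le cu) => n.
pose D i := (w + h) ^+ i - w ^+ i - i%:R * w ^+ i.-1 * h.
have -> : u n = \sum_(i < n.+1) f i * D i.
  rewrite /u /psum -sumrB.
  have -> : h * (\sum_(i < n) cvps_deriv f i * w ^+ i) =
      \sum_(i < n.+1) f i * (i%:R * w ^+ i.-1 * h).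
    rewrite big_ord_recl/= !mul0r mulr0 add0r mulr_sumr.
    by apply: eq_bigr => i _; rewrite /bump/= add1n/=; ring.
  by rewrite -sumrB; apply: eq_bigr => i _; rewrite /D; ring.
apply: le_trans (modc_sum _ (fun i => f i * D i)) _.
apply: (@le_trans _ _ (\sum_(i < n.+1) B / s ^+ 2 * modc h ^+ 2 * 2^-1 ^+ i)).
  apply: ler_sum => i _; rewrite modcM.
  have := expr_taylor_le i ws whs; rewrite -/(D i) => Di.
  have {}Di : modc (D i) <= modc h ^+ 2 * (2 * s) ^+ i / s ^+ 2.
    by rewrite ler_pdivlMr// exprn_gt0.
  have [_ _ /(_ i) fi] := fB.
  apply: le_trans (ler_pM (modc_ge0 _) (modc_ge0 _) fi Di) _.
  rewrite (_ : 2^-1 = rho * (2 * s)); last by rewrite mulrCA rs; field.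
  by rewrite [in leRHS]exprMn le_eqVlt; apply/orP; left; apply/eqP; ring.
rewrite -mulr_sumr (_ : A1 * _ = B / s ^+ 2 * modc h ^+ 2 * 2); last by rewrite /A1; ring.
rewrite ler_wpM2l//; last by apply: geometric_sum_le2; lra.
by rewrite mulr_ge0 ?exprn_ge0 ?modc_ge0// divr_ge0// exprn_ge0// ltW.
Qed.

Lemma cvps_eval_expand f n : \forall w \near (0 : C R),
  cvps_eval f w = \sum_(i < n) f i * w ^+ i + w ^+ n * cvps_eval (cvps_tail n f) w.
Proof.
have fE : f = cvps_poly (\poly_(i < n) f i) + cvps_X (C R) ^+ n * cvps_tail n f.
  apply/cvpsP => i; rewrite coef_cvpsD coef_cvps_XnM coef_cvps_tail /= coef_poly.
  by case: ltnP => ni; rewrite ?addr0// add0r subnK.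
apply: filterS2 (cvps_evalD (cvps_poly (\poly_(i < n) f i)) (cvps_X (C R) ^+ n * cvps_tail n f))
  (cvps_evalM (cvps_X (C R) ^+ n) (cvps_tail n f)) => w.
rewrite -fE => -> ->; rewrite /cvps_X -rmorphXn/= !cvps_eval_poly hornerXn.
by rewrite horner_poly.
Qed.

Lemma cvps_eval_lipschitz f : exists2 s : R, 0 < s & exists2 A : R, 0 <= A &
  forall w, modc w <= s -> modc (cvps_eval f w - f 0%N) <= A * modc w.
Proof.
have [s s0 [A A0 [H1 H2]]] := cvps_taylor f.
exists s => //; exists (A * s + A) => [|w ws].
  by rewrite addr_ge0// mulr_ge0// ltW.
have m0 : modc (0 : C R) <= s by rewrite modc0 ltW.
have := H1 0 w m0; rewrite add0r cvps_eval_at0 => /(_ ws) h1.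
have h2 := H2 0 m0.
have -> : cvps_eval f w - f 0%N = cvps_eval f w - f 0%N - w * cvps_eval (cvps_deriv f) 0
   + w * cvps_eval (cvps_deriv f) 0 by rewrite subrK.
apply: le_trans (modcD _ _) _; rewrite modcM mulrDl.
have w0 := modc_ge0 w.
apply: lerD; last by rewrite mulrC ler_wpM2r.
by apply: le_trans h1 _; rewrite expr2 mulrA ler_wpM2r// ler_wpM2l.
Qed.

(** Dividing by the power of w given by the order n leaves a series whose value at 0 is f_n, which
    is nonzero. *)
Lemma cvps_eval_near_neq0 f : f != 0 ->
  exists2 e : R, 0 < e & forall w, 0 < modc w < e -> cvps_eval f w != 0.
Proof.
move=> /cvps_order[n [fn fmin]].
have [s s0 [A A0 gL]] := cvps_eval_lipschitz (cvps_tail n f).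
have /near_modc[e e0 eP] := cvps_eval_expand f n.
have gn : 0 < modc (f n) by rewrite modc_gt0.
exists (Num.min e (Num.min s (modc (f n) / (A + 1)))).
  by rewrite !lt_min e0 s0 divr_gt0//; lra.
move=> w; rewrite !lt_min => /andP[w0 /and3P[we ws wA]].
rewrite eP ?subr0// big1 ?add0r => [|i _]; last by rewrite fmin// mul0r.
rewrite mulf_neq0 ?expf_neq0 -?modc_gt0//.
have := gL w (ltW ws); rewrite coef_cvps_tail add0n => gw.
have : modc (f n) - modc (cvps_eval (cvps_tail n f) w) <= A * modc w.
  rewrite lerBlDr; apply: le_trans (lerD gw (lexx _)).
  by rewrite modcBC (le_trans _ (modcD _ _))// subrK.
move: wA; rewrite ltr_pdivlMr; last by lra.
by nra.
Qed.

(** Carries vanishing of values near 0 back into the ring of series, where the algebra of common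
    factors takes place. *)
Lemma cvps_eval_inj0 f : (\forall w \near (0 : C R), cvps_eval f w = 0) -> f = 0.
Proof.
move=> /near_modc[e e0 eP]; apply: contrapT => /eqP/cvps_eval_near_neq0[e' e'0 e'P].
pose r := Num.min e e' / 2.
have m0 : 0 < Num.min e e' by rewrite lt_min e0.
have /andP[re re'] : (r < e) && (r < e') by rewrite -lt_min /r; lra.
have r0 : 0 < r by rewrite /r; lra.
have mr : modc ((r%:C)%C : C R) = r by rewrite modc_real gtr0_norm.
have := e'P ((r%:C)%C : C R); rewrite mr r0 re' => /(_ isT).
by rewrite eP ?eqxx// subr0 mr.
Qed.

Lemma cvps_quotient_cvg f : \forall w \near (0 : C R),
  (h^-1 *: (cvps_eval f (h + w) - cvps_eval f w)) @[h --> 0^'] --> cvps_eval (cvps_deriv f) w.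
Proof.
have [s s0 [A A0 [H1 _]]] := cvps_taylor f.
apply/near_modc; exists (s / 2); first by rewrite divr_gt0.
move=> w; rewrite subr0 => ws; apply/cvgrPdist_lt => e e0.
have eR : e = ((complex.Re e)%:C)%C by rewrite RRe_real// gtr0_real.
have eR0 : 0 < complex.Re e by rewrite -ltcR -eR.
apply/near_modc; exists (Num.min (s / 2) (complex.Re e / (A + 1))).
  by rewrite lt_min !divr_gt0//; lra.
move=> h; rewrite subr0 lt_min => /andP[hs hA] h0 /=.
rewrite eR modc_lt.
have hm : 0 < modc h by rewrite modc_gt0.
have ws' : modc w <= s by lra.
have whs : modc (w + h) <= s by apply: le_trans (modcD _ _) _; lra.
have h1 := H1 w h ws' whs.
have h00 : h != 0 by rewrite -modc_gt0.
rewrite (_ : cvps_eval (cvps_deriv f) w - h^-1 *: (cvps_eval f (h + w) - cvps_eval f w) =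
   - (h^-1 * (cvps_eval f (w + h) - cvps_eval f w - h * cvps_eval (cvps_deriv f) w))).
  rewrite modcN -(ltr_pM2l hm) -modcM mulrA divff// mul1r.
  apply: le_lt_trans h1 _; rewrite expr2 mulrCA ltr_pM2l//.
  by move: hA; rewrite ltr_pdivlMr; [nra|lra].
by rewrite [in RHS]mulrBr mulrA mulVf// mul1r opprB (addrC h w).
Qed.

Lemma cvps_eval_holomorphic f : holomorphic_near0 (cvps_eval f).
Proof.
apply: filterS (cvps_quotient_cvg f) => w fw; apply/cvg_ex.
exists (cvps_eval (cvps_deriv f) w).
by under eq_fun do rewrite [_ *: 1]mulr1.
Qed.

Lemma cvps_eval_derive1 f : derive1 (cvps_eval f) 0 = f 1%N.
Proof.
have /near_modc[e e0 /(_ 0)] := cvps_quotient_cvg f.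
rewrite subrr modc0 => /(_ e0) h.
have <- : cvps_eval (cvps_deriv f) 0 = f 1%N by rewrite cvps_eval_at0 /= mulr1.
by rewrite /derive1 (cvg_lim (@norm_hausdorff _ _) h).
Qed.

Lemma ps_convergent_conj f : ps_convergent (fun n => (f n)^*).
Proof. by apply: ps_convergent_le (cvps_conv f) => n; rewrite norm_conjC. Qed.

Definition cvps_conj f := mk_cvps (ps_convergent_conj f).

Lemma near0_conj (Q : C R -> Prop) :
  (\forall w \near (0 : C R), Q w) -> \forall w \near (0 : C R), Q w^*.
Proof.
move=> /near_modc[e e0 eQ]; apply/near_modc; exists e => // w we.
by apply: eQ; move: we; rewrite !subr0 /modc norm_conjC.
Qed.

Lemma cvps_eval_conj f :
  \forall w \near (0 : C R), cvps_eval (cvps_conj f) w = (cvps_eval f w^*)^*.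
Proof.
apply: filterS (near0_conj (cvps_cvg_near f)) => w /cvg_modc fw.
apply/cvps_eval_of_cvg/cvg_modc => e /fw[N NP]; exists N => n /NP.
rewrite (_ : psum (cvps_conj f) w n = (psum f w^* n)^*).
  by rewrite -rmorphB /modc norm_conjC.
rewrite /psum rmorph_sum/=; apply: eq_bigr => i _.
by rewrite rmorphM rmorphXn/= conjCK.
Qed.

End Derivative.

(** * Branches of a stable polynomial *)

Section RootsOfUnity.
Variable R : realType.

Lemma mu_expr (n k : nat) :
  mu R n ^+ k = ((cos (2 * pi / n%:R * k%:R)) +i* sin (2 * pi / n%:R * k%:R))%C.
Proof.
elim: k => [|k IHk]; first by rewrite expr0 mulr0 cos0 sin0.
rewrite exprS IHk /mu; set x := 2 * pi / n%:R.
have -> : x * k.+1%:R = x + x * k%:R by rewrite -[k.+1%:R]natr1; ring.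
rewrite cosD sinD.
by apply/eqP; rewrite eq_complex /= eqxx /= addrC.
Qed.

Lemma mu_primitive n : (0 < n)%N -> n.-primitive_root (mu R n).
Proof.
move=> n0; rewrite /primitive_root_of_unity n0; apply/forallP => /= i.
have nR : 0 < n%:R :> R by rewrite ltr0n.
rewrite unity_rootE mu_expr; apply/eqP.
have [iN|iN] := eqVneq i.+1 n.
  rewrite iN (divfK (lt0r_neq0 nR)) (mulrC 2) mulr_natr cos2pi sin2pi.
  by rewrite eqxx.
apply/negbTE/eqP => -[c1 _].
have iltn : (i.+1 < n)%N by rewrite ltn_neqAle iN ltn_ord.
(* Half the angle lies strictly between 0 and pi, so its sine is positive, whereas cos (2 y) = 1
   would make it zero. *)
pose y := pi * (i.+1%:R / n%:R) : R.
have ypi : 0 < y < pi.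
  rewrite /y mulr_gt0 ?pi_gt0 ?divr_gt0// gtr_pMr ?pi_gt0//.
  by rewrite ltr_pdivrMr// mul1r ltr_nat.
have := sin_gt0_pi ypi; have := cos2Dsin2 y.
have : cos (y *+ 2) = 1.
  by rewrite -c1; congr (cos _); rewrite /y -mulr_natr; field; rewrite gt_eqF.
rewrite cos_mulr2n; nra.
Qed.

End RootsOfUnity.

(** * Sign conditions on a branch and on its leading terms *)

Section Branch.
Variable R : realType.
Implicit Types (f phi : cvps (C R)) (v w t c : C R).

Local Notation Im := (@complex.Im R).

Lemma ImD (x y : C R) : Im (x + y) = Im x + Im y.
Proof. exact: raddfD. Qed.

Lemma Im_sum n (F : nat -> C R) : Im (\sum_(i < n) F i) = \sum_(i < n) Im (F i).
Proof. by elim: n => [|n IHn]; rewrite ?big_ord0// !big_ord_recr/= ImD IHn. Qed.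

Lemma Im_realM (a : R) (x : C R) : Im ((a%:C)%C * x) = a * Im x.
Proof. by case: x => b c; rewrite /Im /= mul0r addr0. Qed.

Lemma Im_eq0 (x : C R) : Im x = 0 -> exists a : R, x = (a%:C)%C.
Proof. by case: x => a b /= ->; exists a. Qed.

(** A boundary point t0 with t0^M = x real and nonzero is moved to t0 (1 + k), where k = i sgn(x)
    eta. To first order its M-th power is x (1 + M k), with imaginary part M |x| eta > 0. For small
    eta the value of phi changes by less than d = - Im phi(t0), so d > 0 is impossible. *)
Lemma near_Im_ge0_closure (M : nat) phi : (0 < M)%N -> phi 0%N = 0 ->
  (\forall t \near (0 : C R), 0 < Im (t ^+ M) -> 0 <= Im (cvps_eval phi t)) ->
  \forall t \near (0 : C R), 0 <= Im (t ^+ M) -> 0 <= Im (cvps_eval phi t).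
Proof.
move=> M0 phi0 /near_modc[e e0 eP].
have [s s0 [A A0 [H1 H2]]] := cvps_taylor phi.
apply/near_modc; have m0 : 0 < Num.min e (Num.min s 1) by rewrite !lt_min e0 s0 ltr01.
exists (Num.min e (Num.min s 1) / 2); first by rewrite divr_gt0.
move=> t0; rewrite subr0 => t0e t0M.
have [me [ms m1]] : Num.min e (Num.min s 1) <= e /\ Num.min e (Num.min s 1) <= s /\
    Num.min e (Num.min s 1) <= 1 by rewrite !ge_min !lexx !orbT.
have [t0e' [t0s t01]] : modc t0 < e / 2 /\ modc t0 < s / 2 /\ modc t0 < 2^-1 by lra.
move: t0M; rewrite le_eqVlt => /orP[/eqP/esym/Im_eq0[x xE]|]; last first.
  by apply: eP; rewrite subr0; lra.
have [t00|t00] := eqVneq t0 0; first by rewrite t00 cvps_eval_at0 phi0.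
have x0 : x != 0.
  by apply: contraNneq t00 => x0; move: xE; rewrite x0 => /eqP; rewrite expf_eq0 M0.
rewrite leNgt; apply/negP => neg.
set d := - Im (cvps_eval phi t0); have d0 : 0 < d by rewrite /d oppr_gt0.
(* The first bound keeps the new point in the disc, the second makes the quadratic remainder of (1 +
   k)^M at most eta / 4, and the third keeps the change of phi, at most 2 A eta |t0|, below d. *)
pose eta := Num.min (2^-1) (Num.min (4 ^- M) (d / (4 * A * modc t0 + 1))).
have t0m := modc_ge0 t0.
have den : 0 < 4 * A * modc t0 + 1 by nra.
have M4 : 0 < 4 ^- M :> R by rewrite invr_gt0 exprn_gt0.
have eta0 : 0 < eta by rewrite !lt_min invr_gt0 ltr0n M4 divr_gt0.
have [eta1 [eta2 eta3]] : eta <= 2^-1 /\ eta <= 4 ^- M /\ eta <= d / (4 * A * modc t0 + 1).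
  by rewrite /eta !ge_min !lexx !orbT.
pose k : C R := (0 +i* (Num.sg x * eta))%C.
have km : modc k = eta.
  by rewrite /modc normc_def/= expr0n add0r sqrtr_sqr normrM normr_sg x0 mul1r gtr0_norm.
have hm : modc (t0 * k) = eta * modc t0 by rewrite modcM km mulrC.
have h1 : modc (t0 * k) <= modc t0 / 2 by rewrite hm mulrC ler_wpM2l.
have y0 : 0 <= eta * modc t0 by rewrite mulr_ge0// ltW.
have y1 : eta * modc t0 <= 1.
  have et : eta <= 1 by lra.
  have tt : modc t0 <= 1 by lra.
  by rewrite mulr_ile1// ltW.
pose t := t0 + t0 * k.
have tm : modc t <= 2 * modc t0 by apply: le_trans (modcD _ _) _; lra.
have tM : 0 < Im (t ^+ M).
  rewrite /t -{1}[t0]mulr1 -mulrDr exprMn xE Im_realM.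
  have m1k : modc (1 + k) <= 2 by apply: le_trans (modcD _ _) _; rewrite modc1 km; lra.
  have m1' : modc (1 : C R) <= 2 by rewrite modc1 ler1n.
  have := expr_taylor_le M m1' m1k; rewrite !expr1n.
  set D := (X in modc X * _ <= _) => Dle.
  have -> : (1 + k) ^+ M = 1 + M%:R * k + D by rewrite /D mulr1; ring.
  clearbody D.
  rewrite !ImD -[M%:R](rmorph_nat (real_complex R)) Im_realM [Im k]/= [Im 1]/= add0r.
  have x_gt0 : 0 < `|x| by rewrite normr_gt0.
  have xb : - (x * Im D) <= `|x| * (eta / 4).
    apply: le_trans (ler_norm _) _; rewrite normrN normrM ler_wpM2l//.
    apply: le_trans (Im_le_modc D) _; rewrite ler_pdivlMr// (_ : 4 = 2 ^+ 2); last by ring.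
    apply: le_trans Dle _; rewrite km (expr2 eta) -mulrA ler_piMr ?(ltW eta0)//.
    rewrite (_ : 2 * 2 = 4 :> R); last by ring.
    by rewrite -ler_pdivlMr ?exprn_gt0// mul1r.
  have M1 : 1 <= M%:R :> R by rewrite ler1n.
  have -> : x * (M%:R * (Num.sg x * eta) + Im D) = M%:R * (`|x| * eta) + x * Im D.
    by rewrite [`|x|]normrEsg; ring.
  have : 0 < `|x| * eta by rewrite mulr_gt0.
  nra.
have te : modc (t - 0) < e by rewrite subr0; lra.
have := eP t te tM; apply/negP; rewrite -ltNge.
have t0s' : modc t0 <= s by lra.
have ts : modc t <= s by lra.
have := H1 t0 (t0 * k) t0s' ts; rewrite -/t hm => h2.
have h3 := H2 t0 t0s'.
pose q := t0 * k * cvps_eval (cvps_deriv phi) t0.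
have -> : cvps_eval phi t = cvps_eval phi t0 +
    ((cvps_eval phi t - cvps_eval phi t0 - q) + q) by ring.
rewrite ImD (ImD _ q) -[Im (cvps_eval phi t0)]opprK -/d.
have h4 : modc q <= A * (eta * modc t0) by rewrite modcM hm mulrC ler_wpM2r// mulr_ge0// ltW.
have h5 : Im q <= modc q by apply: le_trans (ler_norm _) (Im_le_modc q).
have h6 := le_trans (ler_norm _) (Im_le_modc (cvps_eval phi t - cvps_eval phi t0 - q)).
have h7 : eta * (4 * A * modc t0 + 1) <= d by rewrite -ler_pdivlMr.
have {}h7 : 4 * (A * (eta * modc t0)) + eta <= d.
  by rewrite (_ : 4 * _ + _ = eta * (4 * A * modc t0 + 1))//; ring.
have h8 : A * (eta * modc t0) ^+ 2 <= A * (eta * modc t0).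
  by rewrite ler_wpM2l// expr2 ler_piMr.
have h9 : 0 <= A * (eta * modc t0) by rewrite mulr_ge0.
rewrite addrC subr_lt0; apply: lt_le_trans h7.
apply: (@le_lt_trans _ _ (A * (eta * modc t0) + A * (eta * modc t0))).
  by apply: lerD; [exact: le_trans h6 (le_trans h2 h8)|exact: le_trans h5 h4].
rewrite -[X in X < _]addr0 ler_ltD//.
by rewrite (_ : _ + _ = 2 * (A * (eta * modc t0))) ?ler_wpM2r ?ler_nat//; ring.
Qed.

(** For t = r v with r > 0 the sign of Im (t^M) is that of Im (v^M), and Im phi(t) = r^n (Im (phi_n
    v^n) + O(r)); now let r be small. *)
Lemma Im_leading_ge0 (M n : nat) phi v :
  (\forall t \near (0 : C R), 0 <= Im (t ^+ M) -> 0 <= Im (cvps_eval phi t)) ->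
  0 <= Im (v ^+ M) -> (forall i, (i < n)%N -> Im (phi i * v ^+ i) = 0) ->
  0 <= Im (phi n * v ^+ n).
Proof.
move=> /near_modc[e e0 eP] vM vi.
have /near_modc[e' e'0 e'P] := cvps_eval_expand phi n.
have [s s0 [A A0 gL]] := cvps_eval_lipschitz (cvps_tail n phi).
rewrite leNgt; apply/negP => neg; pose d := - Im (phi n * v ^+ n).
have d0 : 0 < d by rewrite oppr_gt0.
have v0 := modc_ge0 v; have vn0 := exprn_ge0 n v0.
pose D := A * modc v ^+ n * modc v + 1.
have D1 : 0 <= A * modc v ^+ n * modc v by rewrite !mulr_ge0.
have D0 : 0 < D by rewrite /D; lra.
pose m := Num.min e (Num.min e' s) / (modc v + 1).
have m0 : 0 < m.
  by apply: divr_gt0; [rewrite !lt_min e0 e'0 s0|lra].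
pose r := Num.min m (d / D) / 2.
have mn0 : 0 < Num.min m (d / D) by rewrite lt_min m0 divr_gt0.
have r0 : 0 < r by rewrite divr_gt0.
have [rm rd] : r < m /\ r < d / D.
  have : Num.min m (d / D) <= m by rewrite ge_min lexx.
  have : Num.min m (d / D) <= d / D by rewrite ge_min lexx orbT.
  by rewrite /r; lra.
pose t : C R := (r%:C)%C * v.
have tm : modc t = r * modc v by rewrite modcM modc_real gtr0_norm.
have tmin : modc t < Num.min e (Num.min e' s).
  have : r * (modc v + 1) < Num.min e (Num.min e' s) by rewrite -ltr_pdivlMr//; lra.
  by rewrite tm mulrDr mulr1; lra.
move: tmin; rewrite !lt_min => /and3P[te te' ts].
have := eP t; rewrite subr0 exprMn -rmorphXn Im_realM => /(_ te).
have rM : 0 <= r ^+ M * Im (v ^+ M) by rewrite mulr_ge0// exprn_ge0// ltW.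
move=> /(_ rM) {rM}.
rewrite e'P ?subr0// ImD (Im_sum _ (fun i => phi i * t ^+ i)) big1 ?add0r => [|i _]; last first.
  by rewrite /t exprMn -rmorphXn mulrCA Im_realM vi ?mulr0.
rewrite /t exprMn -rmorphXn -mulrA Im_realM pmulr_rge0 ?exprn_gt0// -/t.
apply/negP; rewrite -ltNge.
have := gL t (ltW ts); rewrite coef_cvps_tail add0n; set g := cvps_eval _ _ => gt.
have -> : v ^+ n * g = phi n * v ^+ n + v ^+ n * (g - phi n) by ring.
rewrite ImD -[Im (phi n * _)]opprK -/d addrC subr_lt0.
apply: le_lt_trans (ler_norm _) _; apply: le_lt_trans (Im_le_modc _) _.
rewrite modcM modcX; apply: (@le_lt_trans _ _ (modc v ^+ n * (A * modc t))).
  by rewrite ler_wpM2l.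
rewrite tm; move: rd; rewrite ltr_pdivlMr// /D; move: (modc v ^+ n) vn0 => b b0.
by nra.
Qed.

End Branch.

Lemma sum_unity_root (K : fieldType) (z : K) (d n : nat) :
  d.-primitive_root z -> ~~ (d %| n)%N -> \sum_(m < d) (z ^+ m) ^+ n = 0.
Proof.
move=> zd dn; have zn : z ^+ n - 1 != 0.
  by rewrite subr_eq0 -(prim_order_dvd zd).
apply: (mulfI zn); rewrite mulr0.
under eq_bigr do rewrite exprAC.
by rewrite -subrX1 exprAC (prim_expr_order zd) expr1n subrr.
Qed.

Section BranchExpansion.
Variable R : realType.
Implicit Types (phi : cvps (C R)) (v w t c : C R).

Local Notation Im := (@complex.Im R).

(** If this holds for all n, then phi is a real series in t^M. It is boolean so that the first
    failing index can be taken. *)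
Definition real_upto_ramification (M n : nat) phi :=
  (Im (phi n) == 0) && ((phi n == 0) || (M %| n)%N).

Lemma Im_real_term (M n : nat) phi v : Im (v ^+ M) = 0 ->
  real_upto_ramification M n phi -> Im (phi n * v ^+ n) = 0.
Proof.
move=> /Im_eq0[x vM] /andP[/eqP/Im_eq0[a ->]].
case/orP=> [/eqP[->]|/dvdnP[k ->]]; first by rewrite mul0r.
by rewrite mulnC exprM vM -rmorphXn -rmorphM.
Qed.

Lemma real_expr_eq1 (z : C R) (k : nat) : (0 < k)%N -> Im z = 0 -> z ^+ k = 1 -> z ^+ 2 = 1.
Proof.
move=> k0 /Im_eq0[a ->] ak.
have : `|a| ^+ k = 1.
  by rewrite -normrX -modc_real rmorphXn ak modc1.
move=> /eqP; rewrite pexpr_eq1 ?normr_ge0// => /eqP a1.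
by rewrite -rmorphXn -real_normK ?num_real// a1 expr1n.
Qed.

Theorem branch_expansion (M : nat) phi : (0 < M)%N -> phi 0%N = 0 ->
  (\forall t \near (0 : C R), 0 <= Im (t ^+ M) -> 0 <= Im (cvps_eval phi t)) ->
  (forall n, real_upto_ramification M n phi) \/
  exists L, [/\ (0 < L)%N,
    forall n, (n < 2 * L * M)%N -> real_upto_ramification M n phi
    & 0 < Im (phi (2 * L * M)%N)].
Proof.
move=> M0 phi0 H.
have [|/existsNP/cid[k kbad]] := pselect (forall n, real_upto_ramification M n phi).
  by left.
right.
have [n nbad nmin] : exists2 n, ~~ real_upto_ramification M n phi &
    forall i, (i < n)%N -> real_upto_ramification M i phi.
  have /ex_minnP[n nbad nmin] : exists n, ~~ real_upto_ramification M n phi.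
    by exists k; apply/negP.
  exists n => // i ilt; apply: contraT => /nmin; rewrite leqNgt ilt; by [].
pose z := mu R (2 * M).
have zprim : (2 * M).-primitive_root z by apply: mu_primitive; rewrite muln_gt0.
have zM : z ^+ M = -1.
  have /eqP : (z ^+ M) ^+ 2 = 1 by rewrite -exprM mulnC (prim_expr_order zprim).
  rewrite sqrf_eq1 -(prim_order_dvd zprim) => /orP[|/eqP//].
  by move=> /(dvdn_leq M0); rewrite -[X in (_ <= X)%N]mul1n leq_pmul2r.
have Im1 : Im (1 : C R) = 0 by [].
have ImN1 : Im (-1 : C R) = 0 by rewrite /Im /= oppr0.
have lead v : Im (v ^+ M) = 0 -> 0 <= Im (phi n * v ^+ n).
  move=> vM; apply: (Im_leading_ge0 H); first by rewrite vM.
  by move=> i /nmin; exact: Im_real_term.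
have Mn : (M %| n)%N.
  apply: contraT => Mn.
  have sum0 v : Im (v ^+ M) = 0 -> Im (phi n * v ^+ n) = 0.
    move=> vM; pose w := mu R M; have wprim := mu_primitive R M0 : M.-primitive_root w.
    have pos (m : 'I_M) : true -> 0 <= Im (phi n * (v * w ^+ m) ^+ n).
      move=> _; apply: lead.
      by rewrite exprMn -exprM mulnC exprM (prim_expr_order wprim) expr1n mulr1.
    have S0 : \sum_(m < M) Im (phi n * (v * w ^+ m) ^+ n) = 0.
      rewrite -(Im_sum _ (fun m => phi n * (v * w ^+ m) ^+ n)).
      under eq_bigr do rewrite exprMn mulrA.
      by rewrite -mulr_sumr (sum_unity_root wprim Mn) mulr0.
    have := psumr_eq0P pos S0 (i := Ordinal M0) isT.
    by rewrite /= expr0 mulr1.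
  have phin : phi n != 0.
    by apply: contraNneq nbad => pn; rewrite /real_upto_ramification pn !eqxx.
  (* v = 1 shows that phi_n is real, and v = z, for which v^M = -1, that z^n is real. A real root of
     unity has square 1, so 2M divides 2n. *)
  have := sum0 1; rewrite !expr1n mulr1 => /(_ Im1)/Im_eq0[a aE].
  have := sum0 z; rewrite zM aE Im_realM => /(_ ImN1)/eqP.
  have a0 : a != 0 by apply: contraNneq phin => a0; rewrite aE a0.
  rewrite mulf_eq0 (negPf a0)/= => /eqP zn.
  have := @real_expr_eq1 (z ^+ n) (2 * M); rewrite muln_gt0 M0 => /(_ isT zn).
  rewrite -exprM mulnC exprM (prim_expr_order zprim) expr1n => /(_ erefl).
  rewrite -exprM => /eqP; rewrite -(prim_order_dvd zprim) (mulnC n) dvdn_pmul2l//.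
  by rewrite (negPf Mn).
have Imn : Im (phi n) != 0.
  by apply: contraNneq nbad => In; rewrite /real_upto_ramification In eqxx Mn orbT.
have Impos : 0 < Im (phi n).
  by rewrite lt_neqAle eq_sym Imn/=; have := lead 1; rewrite !expr1n mulr1; apply.
move/dvdnP: Mn => [l nE].
have leven : ~~ odd l.
  apply/negP => lodd; have := lead z; rewrite zM => /(_ ImN1).
  have -> : z ^+ n = -1 by rewrite nE mulnC exprM zM -signr_odd lodd expr1.
  by rewrite mulrN1 raddfN/= oppr_ge0 leNgt Impos.
have l0 : (0 < l)%N.
  rewrite lt0n; apply: contraNneq nbad => l0.
  by rewrite /real_upto_ramification nE l0 phi0 /Im /= !eqxx.
have lE : l = (2 * l./2)%N by rewrite mul2n even_halfK.
exists l./2; rewrite -lE -nE; split=> //.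
by rewrite lt0n; apply: contraTneq l0 => h; rewrite lE h.
Qed.

(** Let N be the order of phi. If N <= M, then M divides N, so N = M, and v^M = i gives the sign. If
    N > M, the sum of v^M over the N solutions of phi_N v^N = -i vanishes, so one of them has Im
    (v^M) >= 0, against [Im_leading_ge0]. *)
Theorem branch_leading_coef (M : nat) phi : (0 < M)%N -> phi 0%N = 0 -> phi != 0 ->
  (forall n, (n <= M)%N -> real_upto_ramification M n phi) ->
  (\forall t \near (0 : C R), 0 <= Im (t ^+ M) -> 0 <= Im (cvps_eval phi t)) ->
  exists2 a : R, 0 < a & phi M = (a%:C)%C.
Proof.
move=> M0 phi0 phin0 good H.
have [N [phiN Nmin]] := cvps_order phin0.
have lead v : 0 <= Im (v ^+ M) -> 0 <= Im (phi N * v ^+ N).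
  by move=> vM; apply: (Im_leading_ge0 H vM) => i /Nmin ->; rewrite mul0r.
have rootP (x : C R) k : (0 < k)%N -> exists y : C R, y ^+ k = x.
  by move=> k0; exists (k.-root x); rewrite rootCK.
have N0 : (0 < N)%N by rewrite lt0n; apply: contraNneq phiN => ->; rewrite phi0.
have [NM|MN] := leqP N M.
  have /andP[/eqP/Im_eq0[a aE]] := good N NM; rewrite (negPf phiN)/= => MN.
  have NE : N = M by apply/eqP; rewrite eqn_leq NM dvdn_leq.
  rewrite -NE; exists a => //; have [v vM] := rootP 'i%C M M0.
  have := lead v; rewrite NE vM -NE aE Im_realM /Im /= mulr1 => /(_ ler01).
  by rewrite le_eqVlt => /orP[/eqP a0|//]; rewrite aE -a0 eqxx in phiN.
have [v vN] := rootP (- 'i%C / phi N) N N0.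
pose w := mu R N; have wprim := mu_primitive R N0 : N.-primitive_root w.
have [m mIm] : exists m : 'I_N, 0 <= Im ((v * w ^+ m) ^+ M).
  apply: contrapT => /forallNP neg.
  have : \sum_(m < N) Im ((v * w ^+ m) ^+ M) = 0.
    rewrite -(Im_sum _ (fun m => (v * w ^+ m) ^+ M)).
    under eq_bigr do rewrite exprMn.
    by rewrite -mulr_sumr (sum_unity_root wprim) ?mulr0// gtnNdvd.
  apply/eqP; rewrite lt_eqF// (bigD1 (Ordinal N0))//=.
  have lt0 (m : 'I_N) : Im ((v * w ^+ m) ^+ M) < 0 by rewrite ltNge; apply/negP.
  rewrite -[ltRHS]addr0 ltr_leD ?(lt0 (Ordinal N0))//.
  by apply: sumr_le0 => i _; exact: ltW.
have := lead _ mIm; rewrite exprMn vN -exprM mulnC exprM (prim_expr_order wprim) expr1n mulr1.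
by rewrite mulrC divfK// raddfN/= oppr_ge0 ler10.
Qed.

End BranchExpansion.

(** * Common factors of polynomials vanishing on a curve *)

Section CommonFactor.
Variables (K : numClosedFieldType) (g : cvps K).
Implicit Types p q f : {poly {poly K}}.

(** Restriction to the graph z2 = g(z1). As [cvps] has no zero divisors, the polynomials sent to 0
    form a prime ideal. *)
Definition on_curve p : cvps K := (map_poly (@cvps_poly K) p).[g].

Lemma on_curveM p q : on_curve (p * q) = on_curve p * on_curve q.
Proof. by rewrite /on_curve rmorphM hornerM. Qed.

Lemma on_curveB p q : on_curve (p - q) = on_curve p - on_curve q.
Proof. by rewrite /on_curve rmorphB hornerD hornerN. Qed.

Lemma on_curveC (c : {poly K}) : on_curve c%:P = cvps_poly c.
Proof. by rewrite /on_curve map_polyC hornerC. Qed.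

Lemma cvps_poly_eq0 (c : {poly K}) : cvps_poly c = 0 -> c = 0.
Proof.
move=> c0; apply/polyP => i; rewrite coef0.
by have := congr1 (fun f : cvps K => f i) c0.
Qed.

Lemma dvd_XsubC_coefs (a : K) f : map_poly (horner_eval a) f = 0 ->
  exists h, f = ('X - a%:P)%:P * h.
Proof.
move=> fa; exists (\poly_(i < size f) (f`_i %/ ('X - a%:P))).
apply/polyP => i; rewrite coefCM coef_poly.
case: ltnP => [iF|Fi]; last by rewrite mulr0 nth_default.
rewrite mulrC divpK// dvdp_XsubCl rootE.
by have := congr1 (fun h : {poly K} => h`_i) fa; rewrite coef_map coef0 => /eqP.
Qed.

(* Gauss's lemma by minimality: a curve equation [f] of least degree in z2 and
   then of least leading coefficient is not divisible by any [z1 - a]. *)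
Lemma curve_equation p : p != 0 -> on_curve p = 0 ->
  exists f, [/\ f != 0, on_curve f = 0 & forall q, on_curve q = 0 -> ring_divides f q].
Proof.
move=> p0 pc.
pose eqn f := f != 0 /\ on_curve f = 0.
have [n [[f1 [f1e f1n]] nmin]] : exists n, (exists f, eqn f /\ size f = n) /\
    forall f, eqn f -> (n <= size f)%N.
  have /ex_minnP[n /asboolP nP nmin] : exists n, `[< exists f, eqn f /\ size f = n >].
    by exists (size p); apply/asboolP; exists p.
  exists n; split=> // f fe; apply: nmin; apply/asboolP; by exists f.
have [m [[f [fe fn fm]] mmin]] : exists m,
    (exists f, [/\ eqn f, size f = n & size (lead_coef f) = m]) /\
    forall f, eqn f -> size f = n -> (m <= size (lead_coef f))%N.
  have /ex_minnP[m /asboolP mP mmin] :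
      exists m, `[< exists f, [/\ eqn f, size f = n & size (lead_coef f) = m] >].
    by exists (size (lead_coef f1)); apply/asboolP; exists f1.
  exists m; split=> // f fe fn; apply: mmin; apply/asboolP; by exists f.
have [f0 fc] := fe; exists f; split=> // q qc.
have prim a h : f != ('X - a%:P)%:P * h.
  apply/eqP => fh.
  have Xa0 : 'X - a%:P != 0 :> {poly K} by rewrite polyXsubC_eq0.
  have h0 : h != 0 by apply: contraNneq f0 => h0; rewrite fh h0 mulr0.
  have hc : on_curve h = 0.
    move: fc; rewrite fh on_curveM on_curveC => /cvps_mulf_eq0[/cvps_poly_eq0/eqP|//].
    by rewrite (negPf Xa0).
  have sh : size h = n by rewrite -fn fh mul_polyC size_scale.
  have := mmin h (conj h0 hc) sh; rewrite -fm fh lead_coefM lead_coefC.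
  rewrite size_monicM ?monicXsubC ?lead_coef_eq0// size_XsubC addSn/= add1n.
  by rewrite ltnn.
have [c [c0 [h ch]]] : exists c : {poly K}, c != 0 /\ exists h, c *: q = h * f.
  (* The pseudo-remainder again vanishes on the curve and has smaller degree in z2, so it is zero;
     [f] divides [q] up to a factor in z1 alone. *)
  have E := Pdiv.Idomain.divp_eq q f.
  exists (lead_coef f ^+ scalp q f); split; first by rewrite expf_neq0// lead_coef_eq0.
  exists (q %/ f); rewrite E.
  have [->|r0] := eqVneq (q %% f) 0; first by rewrite addr0.
  have rE : q %% f = (lead_coef f ^+ scalp q f) *: q - q %/ f * f by rewrite E addrC addKr.
  have rc : on_curve (q %% f) = 0.
    by rewrite rE on_curveB -mul_polyC !on_curveM qc fc !mulr0 subr0.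
  have := nmin _ (conj r0 rc); rewrite -fn leqNgt.
  by rewrite ltn_modp f0.
(* The roots of that factor are removed one by one: at a root a, z1 - a divides h f but not f, hence
   it divides h. *)
elim: (size c) {-2}c (leqnn (size c)) c0 h ch => [|k IHk] {}c sc c0 h ch.
  by move: sc c0; rewrite leqn0 size_poly_eq0 => /eqP ->; rewrite eqxx.
have [s1|/closed_rootP[a ca]] := eqVneq (size c) 1.
  have /size_poly1P[b b0 cb] : size c == 1 by apply/eqP.
  exists (b^-1%:P%:P * h); rewrite -mulrA -ch cb -mul_polyC mulrA -!polyCM.
  by rewrite mulVf// !polyC1 mul1r.
have /factor_theorem[c' cE] := ca.
have : map_poly (horner_eval a) h * map_poly (horner_eval a) f = 0.
  rewrite -rmorphM -ch cE; apply/polyP => i; rewrite coef_map coefZ coef0.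
  by rewrite /= /horner_eval !hornerM hornerXsubC subrr mulr0 mul0r.
move=> /eqP; rewrite mulf_eq0 => /orP[] /eqP /dvd_XsubC_coefs[h' hE]; last first.
  by have := prim a h'; rewrite hE eqxx.
have Xa0 : ('X - a%:P)%:P != 0 :> {poly {poly K}} by rewrite polyC_eq0 polyXsubC_eq0.
have c'0 : c' != 0 by apply: contraNneq c0 => c'0; rewrite cE c'0 mul0r.
apply: (IHk c' _ c'0 h').
  move: sc; rewrite cE mulrC size_monicM ?monicXsubC// size_XsubC.
  by rewrite addSn/= add1n ltnS.
apply: (mulfI Xa0); rewrite mulrA -hE -ch cE -!mul_polyC mulrA -polyCM.
by rewrite (mulrC c').
Qed.

Lemma eval2_horner_coef p (z : K * K) :
  eval2 p z = \sum_(i < size p) (p`_i).[z.1] * z.2 ^+ i.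
Proof.
rewrite /eval2 (horner_coef p) horner_sum; apply: eq_bigr => i _.
by rewrite hornerM -polyC_exp hornerC.
Qed.

End CommonFactor.

Section CurveEvaluation.
Variable R : realType.
Implicit Types (p : {poly {poly C R}}) (g : cvps (C R)).

Lemma cvps_eval_on_curve p g : \forall w \near (0 : C R),
  cvps_eval (on_curve g p) w = eval2 p (w, cvps_eval g w).
Proof.
apply: filterS (cvps_eval_horner (map_poly (@cvps_poly (C R)) p) g) => w ->.
rewrite eval2_horner_coef /weierstrass_eval.
have le : (size (map_poly (@cvps_poly (C R)) p) <= size p)%N by exact: size_poly.
rewrite (big_ord_widen (size p) (fun i => cvps_eval (map_poly (@cvps_poly (C R)) p)`_i w
  * cvps_eval g w ^+ i) le) big_mkcond/=.
apply: eq_bigr => i _; rewrite coef_map/= cvps_eval_poly; case: ltnP => // Fi.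
have := nth_default 0 Fi; rewrite coef_map/= => /cvps_poly_eq0 ->.
by rewrite horner0 mul0r.
Qed.

Lemma on_curve_eq0 p g :
  (\forall w \near (0 : C R), eval2 p (w, cvps_eval g w) = 0) -> on_curve g p = 0.
Proof.
move=> H; apply: cvps_eval_inj0.
by apply: filterS2 H (cvps_eval_on_curve p g) => w H ->.
Qed.

(** A graph with real coefficients is mapped to itself by conjugating both coordinates. *)
Lemma real_curve_bar p g : (forall i, (g i)^* = g i) ->
  (\forall w \near (0 : C R), eval2 p (w, cvps_eval g w) = 0) ->
  \forall w \near (0 : C R), eval2 (bar p) (w, cvps_eval g w) = 0.
Proof.
move=> gr H; have gc : cvps_conj g = g by apply/cvpsP.
apply: filterS2 (near0_conj H) (cvps_eval_conj g) => w H1.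
by rewrite gc bar_eval/= => ->; rewrite conjCK H1 rmorph0.
Qed.

(** The equation of the curve divides both [p] and [bar p], so it is constant; but a nonzero
    constant vanishes nowhere. *)
Lemma pure_stable_no_real_curve p g : pure_stable p -> (forall i, (g i)^* = g i) ->
  ~ (\forall w \near (0 : C R), eval2 p (w, cvps_eval g w) = 0).
Proof.
move=> [pH pcop] gr H.
have p0 : p != 0.
  apply: contraTneq (pH ('i, 'i) _ _) => [->||] /=; rewrite ?Im_i ?ltr01//.
  by rewrite /eval2 !horner0 eqxx.
have [f [f0 fc fdvd]] := curve_equation p0 (on_curve_eq0 H).
have [c fE] := pcop f (fdvd _ (on_curve_eq0 H)) (fdvd _ (on_curve_eq0 (real_curve_bar gr H))).
move: fc f0; rewrite fE on_curveC => /cvps_poly_eq0 ->.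
by rewrite eqxx.
Qed.

Lemma var2_divides p : (\forall w \near (0 : C R), eval2 p (w, 0) = 0) ->
  ring_divides (var2 (C R)) p.
Proof.
move=> H; have p00 : p.[0] = 0.
  apply: cvps_poly_eq0; apply: cvps_eval_inj0; apply: filterS H => w.
  by rewrite /eval2/= cvps_eval_poly polyC0.
have /factor_theorem[q ->] : root p 0 by apply/eqP.
by exists q; rewrite subr0.
Qed.

End CurveEvaluation.

(** * Branches of a Weierstrass factor *)

Section BranchesOfFactor.
Variable R : realType.
Implicit Types (p : {poly {poly C R}}) (F : {poly cvps (C R)}) (phi : cvps (C R)).
Local Notation Im := (@complex.Im R).

Lemma near_box (Q : C R * C R -> Prop) :
  (\forall z \near ((0, 0) : C R * C R), Q z) <->
  exists2 e : R, 0 < e & forall z, modc z.1 < e -> modc z.2 < e -> Q z.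
Proof.
split=> [[[A B] /= [/near_modc[a a0 aA] /near_modc[b b0 bB]] ABQ]|[e e0 eQ]].
  exists (Num.min a b); first by rewrite lt_min a0.
  move=> [z1 z2] /=; rewrite !lt_min => /andP[z1a _] /andP[_ z2b]; apply: ABQ.
  by split=> /=; [apply: aA|apply: bB]; rewrite subr0.
exists ([set w | modc w < e], [set w | modc w < e]) => /=.
  by split; apply/near_modc; exists e => // w; rewrite subr0.
by move=> [z1 z2] /= [z1e z2e]; apply: eQ.
Qed.

(** All M-th roots of w have the same modulus, so a small w controls every choice of root at
    once. *)
Lemma near0_roots (Q : C R -> Prop) (M : nat) : (0 < M)%N ->
  (\forall t \near (0 : C R), Q t) ->
  \forall w \near (0 : C R), forall t, t ^+ M = w -> Q t.
Proof.
move=> M0 /near_modc[e e0 eQ]; apply/near_modc; exists (e ^+ M); first by rewrite exprn_gt0.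
move=> w; rewrite subr0 => we t tw; apply: eQ; rewrite subr0.
move: we; rewrite -tw modcX ltr_pXn2r// nnegrE ?modc_ge0//; exact: ltW.
Qed.

Lemma near0_evalphi (e : R) phi : 0 < e -> phi 0%N = 0 ->
  \forall t \near (0 : C R), modc (cvps_eval phi t) < e.
Proof.
move=> e0 phi0; have [s s0 [A A0 H]] := cvps_eval_lipschitz phi.
have A1 : 0 < A + 1 by lra.
apply/near_modc; exists (Num.min s (e / (A + 1))).
  by rewrite lt_min s0 divr_gt0.
move=> t; rewrite subr0 lt_min => /andP[ts]; rewrite ltr_pdivlMr// => te.
have := H t (ltW ts); rewrite phi0 subr0 => h; have := modc_ge0 t; nra.
Qed.

Lemma weierstrass_branch F (M : nat) : is_weierstrass F -> ring_irreducible F ->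
  size F = M.+1 ->
  exists phi, [/\ (0 < M)%N, phi 0%N = 0,
    (1 < M)%N -> exists i, ~~ (M %| i)%N /\ phi i != 0 &
    \forall t \near (0 : C R), forall y, weierstrass_eval F (t ^+ M, y) =
      \prod_(1 <= m < M.+1) (y + cvps_eval phi (mu R M ^+ m * t))].
Proof.
move=> [Fm F0] Firr sF.
have M0 : (0 < M)%N.
  rewrite lt0n; apply/eqP => M0; case: Firr => nu _; apply: nu.
  have FC : F = (F`_0)%:P by apply: size1_polyC; rewrite sF M0.
  by exists 1; rewrite mulr1; move: Fm; rewrite FC monicE lead_coefC => /eqP ->.
have s1 : (1 < size F)%N by rewrite sF.
have [h [FE hM]] := irreducible_puiseux (mu_primitive R) Fm s1 Firr.
rewrite sF/= in FE hM F0.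
have muM := prim_expr_order (mu_primitive R M0).
(* At z1 = 0 a Weierstrass polynomial of degree M becomes X^M, and the constant term of [h] is a
   root of it. *)
have h0 : h 0%N = 0.
  pose cc := @cvps_const_coef (C R).
  have : map_poly cc (map_poly (cvps_ramify M) F) = 'X^M.
    rewrite -map_poly_comp; apply/polyP => i; rewrite coefXn coef_map_id0; last first.
      exact: raddf0.
    rewrite -[LHS]/(cvps_ramify M F`_i 0%N) coef_cvps_ramify dvdn0 div0n.
    case: (ltngtP i M) => [iM|iM|->]; first by rewrite F0.
      by rewrite nth_default// sF.
    by have /monicP := Fm; rewrite /lead_coef sF/= => ->.
  rewrite FE rmorph_prod/= => /(congr1 (horner^~ (h 0%N))).
  rewrite horner_prod (bigD1 (Ordinal M0))//= expr0 cvps_scale1 rmorphB/= map_polyX map_polyC/=.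
  rewrite hornerXsubC /cc /cvps_const_coef subrr mul0r hornerXn => /esym/eqP.
  by rewrite expf_eq0 M0 => /eqP.
exists (- h); split=> //; first by rewrite coef_cvpsN h0 oppr0.
  by move=> /hM[i [Mi hi]]; exists i; rewrite coef_cvpsN oppr_eq0.
have hN : \forall t \near (0 : C R), forall m : 'I_M.+1,
    cvps_eval (- h) (mu R M ^+ m * t) = - cvps_eval h (mu R M ^+ m * t).
  by apply: near0_forall => m; exact: near0_mulr (cvps_evalN h).
have wE := weierstrass_eval_factor M0 FE.
apply: filterS2 hN wE => t {}hN {}wE y; rewrite wE.
rewrite big_add1/= big_mkord.
(* The conjugates were numbered 0, ..., M - 1; as mu^M = 1, the product may run over 1, ..., M. *)
rewrite -(@prod_shift_cyclic _ M (fun m => y - cvps_eval h (mu R M ^+ m * t))); last first.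
  by rewrite muM expr0.
apply: eq_bigr => m _; have mM : (m.+1 < M.+1)%N by rewrite ltnS.
by rewrite (hN (Ordinal mM)).
Qed.

Lemma complex_Im_conj (x : C R) : Im x^* = - Im x.
Proof. by case: x. Qed.

Lemma no_zeros_H2P p (z : C R * C R) : no_zeros_H2 p -> eval2 p z = 0 ->
  0 < Im z.1 -> Im z.2 <= 0.
Proof.
move=> pH pz z1; rewrite leNgt; apply/negP => z2.
have := pH z; rewrite pz eqxx -!complexIm !ltcR => /(_ z1 z2).
by [].
Qed.

End BranchesOfFactor.

Section BranchPolynomialPart.
Variable R : realType.
Implicit Types (p : {poly {poly C R}}) (phi : cvps (C R)).
Local Notation Im := (@complex.Im R).
Local Notation Re := (@complex.Re R).

Definition branch_poly (M d : nat) phi : {poly R} := \poly_(i < d) Re (phi (i * M)%N).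

(** Below index d M only multiples of M carry nonzero coefficients, and these are real: this part is
    a real polynomial in t^M. *)
Lemma branch_polynomial_part (M d : nat) phi : (0 < M)%N ->
  (forall n, (n < d * M)%N -> real_upto_ramification M n phi) ->
  \forall t \near (0 : C R), cvps_eval phi t =
    real_poly_eval (branch_poly M d phi) (t ^+ M) +
    (t ^+ M) ^+ d * cvps_eval (cvps_tail (d * M) phi) t.
Proof.
move=> M0 good; apply: filterS (cvps_eval_expand phi (d * M)) => t ->.
rewrite -exprM (mulnC M); congr (_ + _).
rewrite /real_poly_eval -horner_poly -[t ^+ M]hornerXn -horner_comp; congr (_.[t]).
apply/polyP => i; rewrite coef_comp_poly_Xn// coef_map coef_poly.
case: (boolP (M %| i)%N) => [/dvdnP[l ->]|Mi].
  rewrite mulnK// coef_poly ltn_pmul2r//; case: ltnP => [ld|_].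
    have : (l * M < d * M)%N by rewrite ltn_pmul2r.
    by move/good => /andP[/eqP/Im_eq0[a ->] _].
  by [].
case: ltnP => // /good/andP[_]; rewrite (negPf Mi) orbF => /eqP //.
Qed.

Lemma real_upto_ramification1 n phi : real_upto_ramification 1 n phi ->
  phi n = ((Re (phi n))%:C)%C.
Proof. by move=> /andP[/eqP/Im_eq0[a ->] _]. Qed.

Lemma conj_real (x : C R) : Im x = 0 -> x^* = x.
Proof. by move=> /Im_eq0[a ->]; apply/CrealP; rewrite complex_real. Qed.

Lemma real_stable_conj_zero p (z : C R * C R) : real_stable p ->
  eval2 p z = 0 -> eval2 p (z.1^*, z.2^*) = 0.
Proof.
move=> [_ [c [c1 pE]]] pz; move: pz; rewrite {1}pE /eval2 hornerM hornerC hornerM hornerC.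
have c0 : c != 0 by rewrite -normr_eq0 c1 oner_eq0.
move/eqP; rewrite mulf_eq0 (negPf c0)/= -/(eval2 (bar p) z) bar_eval.
by rewrite conjC_eq0 => /eqP.
Qed.

End BranchPolynomialPart.

Theorem mainTheorem4 (R : realType) (p : {poly {poly C R}}) (k : nat)
    (u : nat -> nat -> C R) (P : 'I_k -> {poly cvps (C R)}) (M : 'I_k -> nat)
    (p_no_zeros : no_zeros_H2 p) (p_vanishes : eval2 p (0, 0) = 0)
    (u_convergent : ps2_convergent u) (u_unit : u 0%N 0%N != 0)
    (P_weierstrass : forall j : 'I_k, is_weierstrass (P j))
    (P_irreducible : forall j : 'I_k, ring_irreducible (P j))
    (P_degree : forall j : 'I_k, size (P j) = (M j).+1)
    (p_factorization : \forall z \near ((0, 0) : C R * C R),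
       eval2 p z = ps2_eval u z * \prod_(j < k) weierstrass_eval (P j) z) :
  (pure_stable p ->
     exists (L : 'I_k -> nat) (q : 'I_k -> {poly R})
            (psi : 'I_k -> C R -> C R),
       (forall j : 'I_k,
          [/\ (0 < L j)%N,
              (q j).[0] = 0 /\ 0 < (deriv (q j)).[0],
              ((size (q j)).-1 < 2 * L j)%N,
              holomorphic_near0 (psi j)
            & 0 < complex.Im (psi j 0)]) /\
       \forall z \near ((0, 0) : C R * C R),
         forall t : 'I_k -> C R,
           (forall j : 'I_k, t j ^+ M j = z.1) ->
           eval2 p z = ps2_eval u z *
             \prod_(j < k) \prod_(1 <= m < (M j).+1)
               (z.2 + real_poly_eval (q j) z.1 +
                z.1 ^+ (2 * L j) * psi j (mu R (M j) ^+ m * t j)))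
  /\
  (real_stable p ->
   ~ ring_divides (var1 (C R)) p -> ~ ring_divides (var2 (C R)) p ->
     (forall j : 'I_k, M j = 1%N) /\
     exists phi : 'I_k -> C R -> C R,
       (forall j : 'I_k,
          [/\ holomorphic_near0 (phi j),
              real_coefficients_near0 (phi j),
              phi j 0 = 0
            & 0 < derive1 (phi j) 0]) /\
       \forall z \near ((0, 0) : C R * C R),
         eval2 p z = ps2_eval u z *
           \prod_(j < k) (z.2 + phi j z.1)).
Proof.
have [e0 e00 pE] := (near_box _).1 p_factorization.
have /choice[phi phiP] := fun j => weierstrass_branch (P_weierstrass j)
  (P_irreducible j) (P_degree j).
have M0 j : (0 < M j)%N by have [] := phiP j.
have phi0 j : phi j 0%N = 0 by have [] := phiP j.
(* The factor with m = M vanishes at z2 = - phi(t), because mu^M = 1. The sign turns Im z2 <= 0 into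
   Im phi >= 0 in what follows. *)
have zeros j : \forall t \near (0 : C R), eval2 p (t ^+ M j, cvps_eval (- phi j) t) = 0.
  have [_ _ _ E] := phiP j.
  have small : \forall w \near (0 : C R), modc w < e0.
    by apply/near_modc; exists e0 => // w; rewrite subr0.
  apply: filterS2 (filterI E (cvps_evalN (phi j)))
    (filterI (near0_expr (M0 j) small) (near0_evalphi e00 (phi0 j))) => t [tE tN] [t1 t2].
  rewrite tN pE/= ?modcN// (bigD1 j)//= tE big_nat_recr//=.
  by rewrite (prim_expr_order (mu_primitive R (M0 j))) mul1r addNr mulr0 mul0r mulr0.
have upper j : \forall t \near (0 : C R),
    0 <= complex.Im (t ^+ M j) -> 0 <= complex.Im (cvps_eval (phi j) t).
  apply: near_Im_ge0_closure => //.
  apply: filterS2 (zeros j) (cvps_evalN (phi j)) => t tz tN tM.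
  by have := no_zeros_H2P p_no_zeros tz tM; rewrite /= tN raddfN oppr_le0.
have real1 j : (forall n, real_upto_ramification (M j) n (phi j)) -> M j = 1%N.
  move=> good; have [_ _ nonram _] := phiP j.
  have := M0 j; rewrite leq_eqVlt => /orP[/eqP//|/nonram[i [Mi pi]]].
  by have /andP[_] := good i; rewrite (negPf Mi) (negPf pi).
have box : \forall z \near ((0, 0) : C R * C R), forall t : 'I_k -> C R,
    (forall j, t j ^+ M j = z.1) -> eval2 p z = ps2_eval u z *
      \prod_(j < k) \prod_(1 <= m < (M j).+1) (z.2 + cvps_eval (phi j) (mu R (M j) ^+ m * t j)).
  have H : \forall w \near (0 : C R), forall j, forall t, t ^+ M j = w -> forall y,
      weierstrass_eval (P j) (t ^+ M j, y) =
      \prod_(1 <= m < (M j).+1) (y + cvps_eval (phi j) (mu R (M j) ^+ m * t)).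
    by apply: near0_forall => j; apply: near0_roots => //; have [] := phiP j.
  have /near_modc[e e1 eP] := H.
  apply/near_box; exists (Num.min e e0); first by rewrite lt_min e1.
  move=> [z1 z2] /=; rewrite !lt_min => /andP[z1e z1e0] /andP[_ z2e0] t tz.
  rewrite pE//; congr (_ * _); apply: eq_bigr => j _.
  have z10 : modc (z1 - 0) < e by rewrite subr0.
  by rewrite -(eP z1 z10 j (t j) (tz j)) (tz j).
split=> [ps|rs ndiv1 ndiv2].
- have /choice[L LP] : forall j, exists L, [/\ (0 < L)%N,
      forall n, (n < 2 * L * M j)%N -> real_upto_ramification (M j) n (phi j)
      & 0 < complex.Im (phi j (2 * L * M j)%N)].
    move=> j; have [good|//] := branch_expansion (M0 j) (phi0 j) (upper j).
    have M1 := real1 j good; exfalso.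
    apply: (@pure_stable_no_real_curve R p (- phi j) ps).
      move=> i; rewrite coef_cvpsN rmorphN; congr (- _); apply: conj_real.
      by have /andP[/eqP] := good i.
    by apply: filterS (zeros j) => t; rewrite M1 expr1.
  (* The terms below the first exceptional index 2 L M form q, and the tail from that index on is
     psi, so that psi(0) is the exceptional coefficient. *)
  exists L, (fun j => branch_poly (M j) (2 * L j) (phi j)),
    (fun j => cvps_eval (cvps_tail (2 * L j * M j) (phi j))).
  split=> [j|].
    have [L0 good Ln] := LP j.
    have phin0 : phi j != 0 by apply: contraTneq Ln => ->; rewrite /= ltxx.
    have [|a a0 phiM] := branch_leading_coef (M0 j) (phi0 j) phin0 _ (upper j).
      move=> n nM; apply: good; apply: leq_ltn_trans nM _.
      by rewrite -[X in (X < _)%N]mul1n ltn_pmul2r//; case: (L j) L0 => // l _; rewrite mul2n doubleS.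
    split=> //.
    - rewrite !horner_coef0 coef_poly coef_deriv coef_poly mul0n mul1n phi0 phiM /=.
      rewrite muln_gt0 L0/=; split=> //.
      by case: (L j) L0 => // l _; rewrite mul2n doubleS.
    - have : (size (branch_poly (M j) (2 * L j) (phi j)) <= 2 * L j)%N by exact: size_poly.
      by case: (size _) => [|s] //= _; rewrite muln_gt0.
    - exact: cvps_eval_holomorphic.
    - by rewrite cvps_eval_at0 coef_cvps_tail add0n.
  have H : \forall w \near (0 : C R), forall j, forall t, t ^+ M j = w ->
      forall m : 'I_(M j).+1, cvps_eval (phi j) (mu R (M j) ^+ m * t) =
      real_poly_eval (branch_poly (M j) (2 * L j) (phi j)) w +
      w ^+ (2 * L j) * cvps_eval (cvps_tail (2 * L j * M j) (phi j)) (mu R (M j) ^+ m * t).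
    apply: near0_forall => j; have [L0 good Ln] := LP j.
    have H : \forall t \near (0 : C R), forall m : 'I_(M j).+1,
        cvps_eval (phi j) (mu R (M j) ^+ m * t) =
        real_poly_eval (branch_poly (M j) (2 * L j) (phi j)) ((mu R (M j) ^+ m * t) ^+ M j) +
        ((mu R (M j) ^+ m * t) ^+ M j) ^+ (2 * L j)
          * cvps_eval (cvps_tail (2 * L j * M j) (phi j)) (mu R (M j) ^+ m * t).
      apply: near0_forall => m.
      exact: near0_mulr (branch_polynomial_part (M0 j) good).
    apply: filterS (near0_roots (M0 j) H) => w Hw t tw m; rewrite {}Hw//.
    suff -> : (mu R (M j) ^+ m * t) ^+ M j = w by [].
    by rewrite exprMn exprAC (prim_expr_order (mu_primitive R (M0 j))) expr1n mul1r.
  have /near_modc[e e1 eP] := H.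
  have /near_box[e' e'0 boxP] := box.
  apply/near_box; exists (Num.min e e'); first by rewrite lt_min e1.
  move=> [z1 z2] /=; rewrite !lt_min => /andP[z1e z1e'] /andP[_ z2e'] t tz.
  rewrite (boxP (z1, z2) z1e' z2e' t tz); congr (_ * _); apply: eq_bigr => j _.
  rewrite big_nat_cond [RHS]big_nat_cond; apply: eq_bigr => m /andP[/andP[_ mM] _] /=.
  have z10 : modc (z1 - 0) < e by rewrite subr0.
  by rewrite (eP z1 z10 j (t j) (tz j) (Ordinal mM)) addrA.
have good j : forall n, real_upto_ramification (M j) n (phi j).
  have [//|[L [L0 good Ln]]] := branch_expansion (M0 j) (phi0 j) (upper j).
  (* The conjugate branch is also a branch of [p], so its first non-real
     coefficient has nonnegative imaginary part too. *)
  have phic0 : cvps_conj (phi j) 0%N = 0 by rewrite /= phi0 rmorph0.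
  have upperc : \forall t \near (0 : C R),
      0 <= complex.Im (t ^+ M j) -> 0 <= complex.Im (cvps_eval (cvps_conj (phi j)) t).
    apply: near_Im_ge0_closure => //.
    apply: filterS3 (near0_conj (zeros j)) (near0_conj (cvps_evalN (phi j)))
      (cvps_eval_conj (phi j)) => t tz tN -> tM.
    have := real_stable_conj_zero rs tz; rewrite /= rmorphXn/= conjCK tN rmorphN.
    move=> /(no_zeros_H2P p_no_zeros)/=/(_ tM).
    by rewrite raddfN/= oppr_le0.
  have := @Im_leading_ge0 _ _ (2 * L * M j) _ 1 upperc.
  rewrite !expr1n mulr1 => /(_ (lexx _)) H; exfalso.
  have /H : forall i, (i < 2 * L * M j)%N -> complex.Im (cvps_conj (phi j) i * 1 ^+ i) = 0.
    move=> i /good/andP[/eqP Ii _].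
    by rewrite expr1n mulr1 /= complex_Im_conj Ii oppr0.
  by rewrite /= complex_Im_conj oppr_ge0 leNgt Ln.
have M1 j := real1 j (good j).
split=> //; exists (fun j => cvps_eval (phi j)); split=> [j|].
  have good1 n : real_upto_ramification 1 n (phi j) by rewrite -(M1 j).
  have phin0 : phi j != 0.
    (* A zero branch would make p vanish on the line z2 = 0, so that z2 would divide it. *)
    apply/eqP => pj0; apply: ndiv2; apply: var2_divides.
    apply: filterS (zeros j) => t.
    by rewrite M1 expr1 pj0 oppr0 cvps_eval0.
  have [|a a0 phi1] := branch_leading_coef (M0 j) (phi0 j) phin0 _ (upper j); first by [].
  split.
  - exact: cvps_eval_holomorphic.
  - exists (fun n => complex.Re (phi j n)).
    apply: filterS (cvps_cvg_near (phi j)) => w.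
    rewrite (_ : series _ = psum (phi j) w)// -seriesE; congr series.
    by apply/funext => n; congr (_ * _); exact/esym/real_upto_ramification1.
  - by rewrite cvps_eval_at0.
  - by rewrite cvps_eval_derive1 -{1}(M1 j) phi1 ltcR.
have /near_box[e e1 boxP] := box.
apply/near_box; exists e => // z z1 z2.
rewrite (boxP z z1 z2 (fun=> z.1)) => [|j]; last by rewrite M1 expr1.
congr (_ * _); apply: eq_bigr => j _; rewrite M1 big_nat1.
by rewrite (prim_expr_order (mu_primitive R (ltnSn 0))) mul1r.
Qed.
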